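(* Let $K$ be an imaginary quadratic field, $f_\rho$ a positive integer, $\underline{\mathfrak c}=f_\rho\sqrt{D_K}\mathcal O_K$. Let $\chi$ be a character of $(\mathcal O_K/\underline{\mathfrak c})^\times$ with $\chi(u)=u$ for $u\in\mathcal O_K^\times$, and let $\varphi$ be a Hecke character of $K$ of infinity type $[-1/2;1,0]$ with conductor $\mathfrak c_f\mid\underline{\mathfrak c}$ whose finite character $\chi'_\varphi$, pulled back to $(\mathcal O_K/\underline{\mathfrak c})^\times$, equals $\chi^{-1}$. If $r$ is a positive integer for which there exists an integral ideal $\mathfrak q_r$ of $\mathcal O_K$ with $\mathrm{Nm}_{K/\mathbb Q}(\mathfrak q_r)=r$ and $\mathfrak q_r\mid\underline{\mathfrak c}\,\mathfrak c_f^{-1}$, then the oldform $\vartheta(\tau;\varphi)|[\mathrm{diag}(r,1)]_2=r\,\vartheta(r\tau;\varphi)$ lies in $F^{\chi^{-1}}(f_\rho)$.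
   Context: Embed $K\subset\mathbb C$ with $\sqrt{D_K}$ in the upper half plane $\mathcal H$; $D_K<0$ the discriminant, $h$ the class number. Hecke character of infinity type $[-1/2;1,0]$ with conductor $\mathfrak c_f$: a homomorphism $\varphi$ from fractional ideals prime to $\mathfrak c_f$ to $\mathbb C^\times$ with $\varphi(\alpha\mathcal O_K)=\alpha\chi'_\varphi(\alpha)$ for $\alpha\in\mathcal O_K$ prime to $\mathfrak c_f$, $\chi'_\varphi$ a character of $(\mathcal O_K/\mathfrak c_f)^\times$, $\mathfrak c_f$ minimal. $\vartheta(\tau;\varphi)=\sum_I\varphi(I)e^{2\pi i\tau\mathrm{Nm}(I)}$ over nonzero integral ideals ($\varphi(I)=0$ if $I$ not prime to $\mathfrak c_f$). For $f$ holomorphic on $\mathcal H$, $(f|[\mathrm{diag}(r,1)]_2)(\tau)=r f(r\tau)$. Let $z_1,\dots,z_h\in\mathcal H$ represent the $\mathbb C$-isomorphism classes of elliptic curves with CM by $\mathcal O_K$, $\mathfrak b_{z_a}=\mathbb Z+z_a\mathbb Z$; for $z=z_a$ let $(a_z,b_z,c_z)$ coprime, $a_z>0$, $a_zz^2+b_zz+c_z=0$. $\Lambda_a$: lattice with basis $e_2,e_1$ and Gram matrix $f_\rho\begin{pmatrix}2a_z&b_z\\ b_z&2c_z\end{pmatrix}$; $G_{\Lambda_a}=\Lambda_a^\vee/\Lambda_a$; $\Omega'_a$ the $\mathbb Q$-linear map with $\Omega'_a(e_2)=\sqrt{2a_zf_\rho}$, $\Omega'_a(e_1)=-\sqrt{2a_zf_\rho}z$;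 $\Omega_a=i\sqrt{|G_{\Lambda_a}|}(2a_zf_\rho)^{-1/2}\Omega'_a$ gives $G_{\Lambda_a}\cong\mathfrak b_{z_a}/\underline{\mathfrak c}\mathfrak b_{z_a}$, on which $(\mathcal O_K/\underline{\mathfrak c})^\times$ acts by multiplication ($g\cdot\beta$). $f_a(\tau;\beta)=\sum_{y\in\Lambda_a^\vee,\,y+\Lambda_a=\beta}\Omega'_a(y)e^{\pi if_\rho|D_K|\tau(y,y)}$. $F_a^{\chi^{-1}}$ is the span over $\beta_0\in G_{\Lambda_a}$ of $\sum_{g}\chi(g)f_a(\tau;g^{-1}\cdot\beta_0)$ (sum over $g\in(\mathcal O_K/\underline{\mathfrak c})^\times$), and $F^{\chi^{-1}}(f_\rho)=\sum_{a=1}^hF^{\chi^{-1}}_a$. *)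

(* Defs.v *)
From HB Require Import structures.
From mathcomp Require Import all_boot all_order all_algebra.
From mathcomp Require Import all_classical all_reals all_analysis.
From mathcomp Require Import complex.
Set Implicit Arguments. Unset Strict Implicit. Unset Printing Implicit Defensive.
Import Order.TTheory GRing.Theory Num.Theory.
Import numFieldNormedType.Exports.
Local Open Scope ring_scope.
Local Open Scope classical_set_scope.
Local Open Scope complex_scope.

(* Fundamental discriminants (imaginary quadratic fields K = Q(sqrt D)).    *)
Definition squarefree_int (m : int) : Prop :=
  forall d : int, (d * d %| m)%Z -> absz d = 1%N.

Definition neg_fund_disc (D : int) : Prop :=
  D < 0 /\
  ((((D %% 4)%Z = 1) /\ squarefree_int D) \/
   (exists m : int, D = 4 * m /\ ((m %% 4)%Z = 2 \/ (m %% 4)%Z = 3)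
                    /\ squarefree_int m)).

Section Defs.
Variable R : realType.
Local Notation C := (R[i]).
(* the same type, viewed as a numFieldType, to get its topology / limits *)
Definition Cnf : numFieldType := R[i].

Definition ofR (x : R) : C := x +i* 0.
Definition ofZ (n : int) : C := n%:~R.
Definition ofQ (q : rat) : C := ratr q.

Definition cexp (w : C) : C :=
  (expR (complex.Re w) * cos (complex.Im w)) +i* (expR (complex.Re w) * sin (complex.Im w)).

Definition sqrtD (D : int) : C := 0 +i* Num.sqrt (- (D%:~R : R)).
Definition omega (D : int) : C := (ofZ D + sqrtD D) / 2.
Definition OK (D : int) : set C :=
  [set x | exists m n : int, x = ofZ m + ofZ n * omega D].

Definition is_ideal (D : int) (I : set C) : Prop :=
  I `<=` OK D /\ I 0 /\ (exists x, I x /\ x != 0) /\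
  (forall x y, I x -> I y -> I (x - y)) /\
  (forall a x, OK D a -> I x -> I (a * x)).

Definition frac_ideal (D : int) (J : set C) : Prop :=
  exists d : int, d != 0 /\ is_ideal D [set ofZ d * x | x in J].

Definition idmul (I J : set C) : set C :=
  [set x | exists s : seq (C * C),
      (forall p, p \in s -> I p.1 /\ J p.2) /\ x = \sum_(p <- s) p.1 * p.2].

Definition pid (D : int) (a : C) : set C := [set a * x | x in OK D].

Definition coprime_id (I J : set C) : Prop :=
  exists x y, I x /\ J y /\ x + y = 1.

(* norm of an integral ideal = index [O_K : I] = |det| of a Z-basis of I
   expressed in the Z-basis (1, omega) of O_K *)
Definition ideal_norm (D : int) (I : set C) (n : nat) : Prop :=
  exists p q s t : int,
    I = [set x | exists m k : int,
           x = ofZ m * (ofZ p + ofZ q * omega D) + ofZ k * (ofZ s + ofZ t * omega D)]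
    /\ absz (p * t - q * s)%R = n.

Definition prime_to (D : int) (cf J : set C) : Prop :=
  frac_ideal D J /\
  exists I1 I2, is_ideal D I1 /\ is_ideal D I2 /\ coprime_id I1 cf /\
                coprime_id I2 cf /\ idmul J I2 = I1.

(* chi is a character of (O_K / m)^x, given as a function on O_K
   (only its values on elements prime to m matter) *)
Definition residue_char (D : int) (m : set C) (chi : C -> C) : Prop :=
  (forall a b, OK D a -> OK D b -> coprime_id (pid D a) m ->
     coprime_id (pid D b) m -> m (a - b) -> chi a = chi b) /\
  (forall a b, OK D a -> OK D b -> coprime_id (pid D a) m ->
     coprime_id (pid D b) m -> chi (a * b) = chi a * chi b) /\
  (forall a, OK D a -> coprime_id (pid D a) m -> chi a != 0).

(* phi is a Hecke character of infinity type [-1/2;1,0] with conductor cf and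
   finite character chi' : phi(alpha O_K) = alpha chi'(alpha); cf is minimal,
   i.e. chi' does not factor through (O_K/c')^x for any proper divisor c' of cf *)
Definition hecke_char (D : int) (cf : set C) (phi : set C -> C) (chi' : C -> C)
  : Prop :=
  is_ideal D cf /\ residue_char D cf chi' /\
  (forall J1 J2, prime_to D cf J1 -> prime_to D cf J2 ->
     phi (idmul J1 J2) = phi J1 * phi J2) /\
  (forall J, prime_to D cf J -> phi J != 0) /\
  (forall a, OK D a -> coprime_id (pid D a) cf -> phi (pid D a) = a * chi' a) /\
  (forall c', is_ideal D c' -> cf `<=` c' -> c' <> cf ->
     exists a b, [/\ OK D a, OK D b, coprime_id (pid D a) cf,
                     coprime_id (pid D b) cf & c' (a - b)] /\ chi' a != chi' b).

(* theta(tau; phi) = sum_I phi(I) e^{2 pi i tau Nm(I)}, summed by norm *)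
Definition theta_coef (D : int) (cf : set C) (phi : set C -> C) (n : nat) : C :=
  (\sum_(I \in [set I | is_ideal D I /\ ideal_norm D I n])
      (if `[< coprime_id I cf >] then phi I else 0))%R.

Definition theta (D : int) (cf : set C) (phi : set C -> C) (tau : C) : C :=
  limn (series (fun n : nat =>
    (theta_coef D cf phi n * cexp (2%:R * ofR pi * 'i * tau * n%:R) : Cnf))).

(* Lattices C/(Z + zZ) (complex elliptic curves) with CM by O_K             *)
Definition latt (w1 w2 : C) : set C :=
  [set x | exists m n : int, x = ofZ m * w1 + ofZ n * w2].
Definition latt_End (L : set C) : set C := [set a | forall x, L x -> L (a * x)].
Definition homothetic (L L' : set C) : Prop :=
  exists l : C, l != 0 /\ L' = [set l * x | x in L].

(* The lattice Lambda_a = Z e2 + Z e1 with Gram matrix f[[2a,b],[b,2c]];     *)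
(* vectors of Lambda_a (x) Q are pairs (y2, y1) of coordinates on (e2, e1). *)
Definition gram (f : nat) (A B Cc : int) (x y : rat * rat) : rat :=
  f%:R * (2%:R * A%:~R * x.1 * y.1 + B%:~R * (x.1 * y.2 + x.2 * y.1)
          + 2%:R * Cc%:~R * x.2 * y.2).

Definition in_lat (y : rat * rat) : Prop :=
  exists m n : int, y = (m%:~R, n%:~R).

Definition in_dual (f : nat) (A B Cc : int) (y : rat * rat) : Prop :=
  (exists k : int, gram f A B Cc y (1, 0) = k%:~R) /\
  (exists k : int, gram f A B Cc y (0, 1) = k%:~R).

(* |G_Lambda| = |Lambda^vee / Lambda| = |det Gram| *)
Definition disc_order (f : nat) (A B Cc : int) : nat :=
  absz ((f%:Z * f%:Z) * (4 * A * Cc - B * B))%R.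

Definition Omega' (f : nat) (A : int) (z : C) (y : rat * rat) : C :=
  ofR (Num.sqrt (2%:R * A%:~R * f%:R)) * (ofQ y.1 - ofQ y.2 * z).

Definition Omega (f : nat) (A B Cc : int) (z : C) (y : rat * rat) : C :=
  'i * ofR (Num.sqrt (disc_order f A B Cc)%:R)
     * (ofR (Num.sqrt (2%:R * A%:~R * f%:R)))^-1 * Omega' f A z y.

Definition Z2sum (F : int -> int -> C) : C :=
  limn (fun N : nat =>
    (\sum_(i < N.*2.+1) \sum_(j < N.*2.+1)
        F (i%:Z - N%:Z) (j%:Z - N%:Z) : Cnf)).

(* f_a(tau; g^{-1} . [y0]), where alpha in O_K represents g in (O_K/c)^x.
   y ranges over Lambda^vee with g.(y + Lambda) = y0 + Lambda, i.e.
   alpha Omega(y) = Omega(y0) mod Omega(Lambda).  Since Lambda^vee is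
   contained in (1/d) Z^2 with d = |det Gram|, we sum over (1/d) Z^2. *)
Definition f_act (D : int) (f : nat) (A B Cc : int) (z : C) (a : C)
  (y0 : rat * rat) (tau : C) : C :=
  let d := (disc_order f A B Cc)%:R : rat in
  Z2sum (fun m n =>
    let y := (m%:~R / d, n%:~R / d) in
    if `[< in_dual f A B Cc y /\
           exists l, in_lat l /\
             a * Omega f A B Cc z y = Omega f A B Cc z y0 + Omega f A B Cc z l >]
    then Omega' f A z y *
         cexp (ofR pi * 'i * f%:R * ofZ (absz D) * tau * ofQ (gram f A B Cc y y))
    else 0).

Definition cbar (D : int) (f : nat) : set C := pid D (f%:R * sqrtD D).

(* sum_{g in (O_K/c)^x} chi(g) f_a(tau; g^{-1} . [y0]); the elements
   x + y omega with 0 <= x, y < N := f|D| run over O_K / N O_K, and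
   N O_K has index |D| in c, so each class of O_K/c is hit |D| times. *)
Definition F_gen (D : int) (f : nat) (chi : C -> C) (A B Cc : int) (z : C)
  (y0 : rat * rat) (tau : C) : C :=
  let N := (f * absz D)%N in
  ((absz D)%:R)^-1 *
  \sum_(x < N) \sum_(y < N)
     (let a := ofZ x%:Z + ofZ y%:Z * omega D in
      if `[< coprime_id (pid D a) (cbar D f) >]
      then chi a * f_act D f A B Cc z a y0 tau else 0).

End Defs.

(* Main.v *)
Require Import Defs.
From HB Require Import structures.
From mathcomp Require Import all_boot all_order all_algebra finmap.
From mathcomp Require Import all_classical all_reals all_analysis.
From mathcomp Require Import complex ring lra zify.
Import Order.TTheory GRing.Theory Num.Theory.
Import numFieldNormedType.Exports.
Set Implicit Arguments. Unset Strict Implicit. Unset Printing Implicit Defensive.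
Local Open Scope ring_scope.
Local Open Scope classical_set_scope.
Local Open Scope complex_scope.

(** Write [b = Z + Z z] for a CM lattice, [A] for the leading coefficient of the
    primitive form of [z], and [c = f sqrt(D) O_K].  The map [Omega] identifies the
    dual lattice with [b] and the lattice itself with [c b], so the generators of
    the span are [sum_w kappa w e(A |w|^2 tau) sum_(g w = w0 mod c b) chi(g)].
    If [psi] is a function on [b / c b] with [psi(g w) = chi(g)^-1 psi(w)], summing
    [psi(w0)] times the generator of [w0] over all classes [w0] gives a nonzero
    multiple of [sum_w psi(w) kappa w e(A |w|^2 tau)].

    Every ideal class contains an ideal prime to [c], because a primitive form
    represents an integer prime to any given level; hence [q b = mu M] with [M]
    integral and prime to [c_f].  The integral ideals [I] are, up to units, in
    bijection with the pairs (class, [0 != alpha] in [M]) by [I M = alpha O_K], and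
    [phi(I) phi(M) = alpha chi'(alpha)] when [I] is prime to [c_f].  So with
    [w = mu alpha] the theta series is a combination of the sums above for
    [psi(w) = chi'(w / mu)], extended by zero; this [psi] is periodic modulo [c b]
    because [c] is contained in [q c_f]. *)
(* In [ring_scope] the symbol would otherwise denote [Num.conj]. *)
Local Notation "x ^*" := (conjc x) : ring_scope.

(** * Complex numbers and the ring of integers *)

(** The ideal [q] may share factors with [c_f], so [phi(q)] need not be meaningful; replacing [q b]
    by a multiple of an [M] prime to [c_f] restores a usable value [phi(M)]. Taking norms in
    [q b = mu M], where [b] has norm [1 / A], gives [r = A |mu|^2 Nm(M)], hence [A |w|^2 = r Nm(I)]
    for [w = mu alpha]: this is where the dilation by [r] comes from. Multiplication by [q] permutes
    the ideal classes, so one [M] for each [b] still reaches every class. Ideals are never factored.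
    The inverse of a module is its conjugate divided by its norm, and the primitive form attached to
    a basis is what shows that this inverse exists. Two orders of summation have to be reconciled:
    [theta] is summed by norm, each generator over growing square boxes of numerators. Gaussian
    decay makes the generators unconditionally summable, so both orders compute the same value. *)

Section ComplexFacts.
Variable R : realType.
Local Notation C := R[i].
Implicit Types x y z : C.

Lemma intr_complex (m : int) : (m%:~R : C) = (m%:~R : R)%:C.
Proof. by rewrite -(rmorph_int (real_complex R)). Qed.

Lemma Im_int_comb (m n : int) z :
  complex.Im (m%:~R + n%:~R * z) = n%:~R * complex.Im z.
Proof. by rewrite !intr_complex; case: z => a b /=; rewrite mul0r addr0 add0r. Qed.

Lemma conjcD x y : (x + y)^* = x^* + y^*.
Proof. exact: (rmorphD (@conjc R)). Qed.
Lemma conjcM x y : (x * y)^* = x^* * y^*.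
Proof. exact: (rmorphM (@conjc R)). Qed.
Lemma conjcN x : (- x)^* = - x^*.
Proof. exact: (rmorphN (@conjc R)). Qed.
Lemma conjcB x y : (x - y)^* = x^* - y^*.
Proof. exact: (rmorphB (@conjc R)). Qed.

Lemma conjc_int (m : int) : (m%:~R : C)^* = m%:~R.
Proof. by rewrite intr_complex conjc_real. Qed.

Lemma int_comb_eq0 (m n : int) z : complex.Im z != 0 ->
  m%:~R + n%:~R * z = 0 -> m = 0 /\ n = 0.
Proof.
move=> hz e; have := congr1 (@complex.Im R) e; rewrite Im_int_comb /= => /eqP.
rewrite mulf_eq0 (negPf hz) orbF intr_eq0 => /eqP n0.
move: e; rewrite n0 mul0r addr0 => /eqP; rewrite intr_eq0 => /eqP ->; by [].
Qed.

Lemma mul_conjc_ge0 x : 0 <= x * x^*.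
Proof. exact: mulcJ_ge0. Qed.

Lemma mul_conjc_gt0 x : x != 0 -> 0 < x * x^*.
Proof.
by move=> x0; rewrite lt_def mulcJ_ge0 andbT mulf_neq0// conjc_eq0.
Qed.

Lemma conjc_ge0 x : 0 <= x -> x^* = x.
Proof. by move=> /ger0_Im; case: x => a b /= ->; rewrite oppr0. Qed.

Lemma sqrtD_sqr (D : int) : D < 0 -> sqrtD R D * sqrtD R D = D%:~R.
Proof.
move=> D0; rewrite intr_complex /sqrtD.
apply/eqP; rewrite eq_complex /= !mul0r !mulr0 !add0r eqxx andbT.
by rewrite -expr2 sqr_sqrtr ?opprK// oppr_ge0 ltW// ltrz0.
Qed.

Lemma Im_sqrtD_gt0 (D : int) : D < 0 -> 0 < complex.Im (sqrtD R D).
Proof. by move=> D0; rewrite /sqrtD /= sqrtr_gt0 oppr_gt0 ltrz0. Qed.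

Lemma sqrtD_neq0 (D : int) : D < 0 -> sqrtD R D != 0.
Proof.
by move=> /Im_sqrtD_gt0; apply: contraTneq => ->; rewrite ltxx.
Qed.

Lemma conjc_sqrtD (D : int) : (sqrtD R D)^* = - sqrtD R D.
Proof. by rewrite /sqrtD; apply/eqP; rewrite eq_complex /= oppr0 !eqxx. Qed.

End ComplexFacts.

(** The quotient is the norm of [omega], the constant term of its minimal polynomial. *)
Lemma fund_disc_mod4 (D : int) : neg_fund_disc D -> exists e : int, D * D - D = 4 * e.
Proof.
move=> [_ [[h _]|[m [-> _]]]].
  exists (D * (D %/ 4)%Z); have e := divz_eq D 4; rewrite h in e.
  rewrite {2 3}e; nia.
exists (4 * m * m - m); ring.
Qed.

(** Arithmetic form of the maximality of [O_K]: an order of discriminant [Q] containing it would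
    contain it with index [|n|]. *)
Lemma fund_disc_square_factor (D n Q : int) : neg_fund_disc D ->
  D = n * n * Q -> (exists k, Q = 4 * k \/ Q = 4 * k + 1) -> n = 1 \/ n = -1.
Proof.
have abs1 (k : int) : absz k = 1%N -> k = 1 \/ k = -1 by lia.
move=> [_ [[_ sf]|[m [Dm [m4 sf]]]]] Dn [k Qk].
  by apply/abs1/sf/dvdzP; exists Q; rewrite Dn mulrC.
have em := divz_eq m 4; set q := (m %/ 4)%Z in em.
have en := divz_eq n 2; set p := (n %/ 2)%Z in en.
have : (n %% 2)%Z = 0 \/ (n %% 2)%Z = 1 by lia.
case=> h; rewrite h in en.
  (* For [n = 2 p], squarefreeness leaves [m = Q], but [Q] is 0 or 1 modulo 4 and [m] is 2 or 3. *)
  have mp : m = p * p * Q by nia.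
  have : absz p = 1%N by apply/sf/dvdzP; exists Q; rewrite mp mulrC.
  case/abs1 => pE; rewrite pE in mp; lia.
apply/abs1/sf/dvdzP.
(* For odd [n] the square [n * n] is 1 modulo 4, so the factor 4 of [D] lies in [Q], and [m] is
   [n * n] times [Q / 4]. *)
have : (4 %| Q)%Z.
  have : (4 %| n * n * Q)%Z by rewrite -Dn Dm dvdz_mulr.
  rewrite Gauss_dvdzr//.
  rewrite /coprimez; apply/eqP.
  have -> : n * n = (p * p + p) * 4 + 1 by nia.
  by rewrite gcdzMDl gcdz1.
case/dvdzP => Q' QE; exists Q'; nia.
Qed.

Section QuadraticOrder.
Variables (R : realType) (D : int).
Hypothesis hD : neg_fund_disc D.
Local Notation C := R[i].
Local Notation OK := (@Defs.OK R D).
Local Notation w := (omega R D).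
Local Notation delta := (sqrtD R D).
Implicit Types (x y : C) (I J K L M : set C).

Let D0 : D < 0. Proof. by case: hD. Qed.

Lemma omega2E : w * 2 = D%:~R + delta.
Proof. by rewrite /omega divfK// pnatr_eq0. Qed.

Lemma omega_root : exists e : int, w * w = D%:~R * w - e%:~R.
Proof.
have [e he] := fund_disc_mod4 hD; exists e.
have two0 : (4 : C) != 0 by rewrite pnatr_eq0.
apply: (mulfI two0); have h := omega2E; have h2 := sqrtD_sqr R D0.
have -> : 4 * (w * w) = (w * 2) * (w * 2) by ring.
have he' : (4 : C) * e%:~R = D%:~R * D%:~R - D%:~R.
  by rewrite -!(intrM, intrB) he intrM.
rewrite mulrBr he' h mulrCA -[4]/((2 * 2)%:R) natrM.
have -> : D%:~R * (2%:R * 2%:R * w) = (D%:~R * 2) * (w * 2) by ring.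
rewrite h -[in RHS]h2; ring: h2.
Qed.

Lemma conjc_omega : w^* = D%:~R - w.
Proof.
have two0 : (2 : C) != 0 by rewrite pnatr_eq0.
apply: (mulIf two0); rewrite mulrBl omega2E -[X in _ * X](conjc_nat R 2) -conjcM omega2E.
rewrite conjcD conjc_int conjc_sqrtD; ring.
Qed.

Lemma omega_sub_conjc : w - w^* = delta.
Proof. rewrite conjc_omega; have := omega2E => h; ring: h. Qed.

Lemma Im_omega_neq0 : complex.Im w != 0.
Proof.
apply/eqP => h; have := omega_sub_conjc; rewrite subcJ h mulr0 mul0r => /esym/eqP.
by rewrite (negPf (sqrtD_neq0 R D0)).
Qed.

Lemma OK_int (m : int) : OK m%:~R.
Proof. by exists m, 0; rewrite /ofZ mul0r addr0. Qed.
Lemma OK0 : OK 0. Proof. exact: (OK_int 0). Qed.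
Lemma OK1 : OK 1. Proof. exact: (OK_int 1). Qed.
Lemma OK_omega : OK w. Proof. by exists 0, 1; rewrite /ofZ add0r mul1r. Qed.
Lemma OKB x y : OK x -> OK y -> OK (x - y).
Proof.
move=> [m [n ->]] [k [l ->]]; exists (m - k), (n - l); rewrite /ofZ !intrB; ring.
Qed.
Lemma OKN x : OK x -> OK (- x).
Proof. by move=> /(OKB OK0); rewrite sub0r. Qed.
Lemma OKD x y : OK x -> OK y -> OK (x + y).
Proof. by move=> hx /OKN /(OKB hx); rewrite opprK. Qed.
Lemma OKM x y : OK x -> OK y -> OK (x * y).
Proof.
have [e he] := omega_root.
move=> [m [n ->]] [k [l ->]].
exists (m * k - n * l * e), (m * l + n * k + n * l * D).
rewrite /ofZ !(intrB, intrD, intrM); ring: he.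
Qed.
Lemma OK_conjc x : OK x -> OK x^*.
Proof.
move=> [m [n ->]]; exists (m + n * D), (- n).
rewrite /ofZ conjcD conjcM !conjc_int conjc_omega intrD intrM mulrNz; ring.
Qed.
Lemma OK_sqrtD : OK delta.
Proof. by rewrite -omega_sub_conjc; apply/OKB/OK_conjc/OK_omega/OK_omega. Qed.

Lemma OK_norm x : OK x -> exists n : nat, x * x^* = n%:R.
Proof.
have [e he] := omega_root.
move=> [m [n xE]].
have h : x * x^* = (m * m + m * n * D + n * n * e)%:~R.
  rewrite xE /ofZ conjcD conjcM !conjc_int conjc_omega !(intrD, intrM); ring: he.
have := mul_conjc_ge0 x; rewrite h ler0z => /ZnatP [k ->]; by exists k.
Qed.

End QuadraticOrder.

(** * Products of lattices *)

Section ProductSets.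
Variables (R : realType).
Local Notation C := R[i].
Implicit Types (x y c d : C) (I J K L M : set C).

Definition scal c L : set C := [set c * x | x in L].
Definition conjs L : set C := [set x^* | x in L].

Lemma scalA c d L : scal c (scal d L) = scal (c * d) L.
Proof.
apply/seteqP; split => x.
  by move=> [y [t Lt <-] <-]; exists t => //; rewrite mulrA.
by move=> [t Lt <-]; exists (d * t); [exists t|rewrite mulrA].
Qed.

Lemma scal1 L : scal 1 L = L.
Proof.
apply/seteqP; split => x; first by move=> [y Ly <-]; rewrite mul1r.
by move=> Lx; exists x => //; rewrite mul1r.
Qed.

Lemma scalE c L x : c != 0 -> scal c L x <-> L (x / c).
Proof.
move=> c0; split; first by move=> [y Ly <-]; rewrite mulrC mulKf.
by move=> h; exists (x / c) => //; rewrite mulrCA divff// mulr1.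
Qed.

Lemma scal_inj c I J : c != 0 -> scal c I = scal c J -> I = J.
Proof.
by move=> c0 /(congr1 (scal c^-1)); rewrite !scalA mulVf// !scal1.
Qed.

Lemma conjsK L : conjs (conjs L) = L.
Proof.
apply/seteqP; split => x; first by move=> [y [t Lt <-] <-]; rewrite conjcK.
by move=> Lx; exists x^*; [exists x|rewrite conjcK].
Qed.

Lemma conjs_scal c L : conjs (scal c L) = scal c^* (conjs L).
Proof.
apply/seteqP; split => x.
  by move=> [y [t Lt <-] <-]; exists t^*; [exists t|rewrite conjcM].
by move=> [y [t Lt <-] <-]; exists (c * t); [exists t|rewrite conjcM].
Qed.

Lemma conjsP L x : conjs L x <-> L x^*.
Proof.
split; first by move=> [y Ly <-]; rewrite conjcK.
by move=> h; exists x^* => //; rewrite conjcK.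
Qed.

Lemma idmul0 I J : idmul I J 0.
Proof. by exists [::]; rewrite big_nil. Qed.

Lemma idmul_mem I J x y : I x -> J y -> idmul I J (x * y).
Proof.
move=> Ix Jy; exists [:: (x, y)]; rewrite big_seq1; split=> // p.
by rewrite inE => /eqP ->.
Qed.

Lemma idmulD I J x y : idmul I J x -> idmul I J y -> idmul I J (x + y).
Proof.
move=> [s [hs ->]] [t [ht ->]]; exists (s ++ t); rewrite big_cat; split=> // p.
by rewrite mem_cat => /orP[/hs|/ht].
Qed.

Lemma idmul_ind K I J : K 0 -> (forall x y, K x -> K y -> K (x + y)) ->
  (forall x y, I x -> J y -> K (x * y)) -> idmul I J `<=` K.
Proof.
move=> K0 KD KM x [s [hs ->]]; elim: s hs => [|p s ih] hs; first by rewrite big_nil.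
rewrite big_cons; apply: KD; last by apply: ih => q hq; apply: hs; rewrite inE hq orbT.
by have [] := hs p (mem_head _ _); exact: KM.
Qed.

Lemma idmul_subset I I' J J' : I `<=` I' -> J `<=` J' -> idmul I J `<=` idmul I' J'.
Proof.
move=> sI sJ x [s [hs ->]]; exists s; split=> // p /hs [/sI ? /sJ ?]; by split.
Qed.

Lemma idmulC I J : idmul I J = idmul J I.
Proof.
suff h (A B : set C) : idmul A B `<=` idmul B A by apply/seteqP; split; exact: h.
apply: (@idmul_ind (idmul B A)) => [|x y|x y Ax By]; [exact: idmul0|exact: idmulD|].
by rewrite mulrC; exact: idmul_mem.
Qed.

Lemma idmulA I J K : idmul I (idmul J K) = idmul (idmul I J) K.
Proof.
have h (A B E : set C) : idmul A (idmul B E) `<=` idmul (idmul A B) E.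
  apply: (@idmul_ind (idmul (idmul A B) E)) => [|x y|x y Ax]; [exact: idmul0|exact: idmulD|].
  have hs : idmul B E `<=` [set y | idmul (idmul A B) E (x * y)].
    apply: (@idmul_ind [set y | idmul (idmul A B) E (x * y)]) => [|u v|u v Bu Ev] /=.
    - by rewrite mulr0; exact: idmul0.
    - by rewrite mulrDr; exact: idmulD.
    - by rewrite mulrA; apply: idmul_mem => //; exact: idmul_mem.
  exact: hs.
apply/seteqP; split; first exact: h.
rewrite (idmulC (idmul I J)) (idmulC I J) (idmulC I) (idmulC J K); exact: h.
Qed.

Lemma idmul_scal c I J : idmul (scal c I) J = scal c (idmul I J).
Proof.
apply/seteqP; split.
  apply: (@idmul_ind (scal c (idmul I J))).
  - by exists 0; [exact: idmul0|rewrite mulr0].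
  - by move=> _ _ [x hx <-] [y hy <-]; exists (x + y); [exact: idmulD|rewrite mulrDr].
  - move=> _ y [x hx <-] hy; exists (x * y); [exact: idmul_mem|by rewrite mulrA].
move=> _ [x hx <-]; move: x hx.
apply: (@idmul_ind [set x | idmul (scal c I) J (c * x)]) => [|x y|x y Ix Jy] /=.
- by rewrite mulr0; exact: idmul0.
- by rewrite mulrDr; exact: idmulD.
- by rewrite mulrA; apply: idmul_mem => //; exists x.
Qed.

Lemma idmul_scalr c I J : idmul I (scal c J) = scal c (idmul I J).
Proof. by rewrite idmulC idmul_scal idmulC. Qed.

Lemma conjs_idmul I J : conjs (idmul I J) = idmul (conjs I) (conjs J).
Proof.
have h (A B : set C) : conjs (idmul A B) `<=` idmul (conjs A) (conjs B).
  move=> _ [x hx <-]; move: x hx.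
  apply: (@idmul_ind (fun x => idmul (conjs A) (conjs B) x^*)) => [|x y|x y Ax By].
  - by rewrite conjc0; exact: idmul0.
  - by rewrite conjcD; exact: idmulD.
  - by rewrite conjcM; apply: idmul_mem; [exists x|exists y].
apply/seteqP; split; first exact: h.
move=> x hx; apply/conjsP.
rewrite -[I]conjsK -[J]conjsK; apply: (h (conjs I) (conjs J)).
by exists x.
Qed.

End ProductSets.

(** * Invertible modules over the ring of integers and their norms *)

Section Modules.
Variables (R : realType) (D : int).
Hypothesis hD : neg_fund_disc D.
Local Notation C := R[i].
Local Notation OK := (@Defs.OK R D).
Local Notation pid := (@Defs.pid R D).
Implicit Types (x y c d : C) (I J K L M : set C).

(** No rank or discreteness is asked: [0] and [C] qualify. Invertibility is the business of
    [rel_norm]. *)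
Definition OKmod L : Prop :=
  [/\ L 0, forall x y, L x -> L y -> L (x - y) & forall a x, OK a -> L x -> L (a * x)].

(* [rho] is the positive generator of [L * conj L], that is, the norm of the
   invertible module [L]; it is multiplicative without choosing any basis. *)
Definition rel_norm L (rho : C) : Prop :=
  [/\ OKmod L, 0 < rho & idmul L (conjs L) = pid rho].

Lemma OKmodN L x : OKmod L -> L x -> L (- x).
Proof. by move=> [L0 LB _] Lx; rewrite -sub0r; exact: LB. Qed.

Lemma OKmodD L x y : OKmod L -> L x -> L y -> L (x + y).
Proof. by move=> hL Lx /(OKmodN hL) Ly; case: hL => _ LB _; rewrite -[y]opprK; exact: LB. Qed.

Lemma OKmodMz L (m : int) x : OKmod L -> L x -> L (m%:~R * x).
Proof. by move=> [_ _ LM]; apply: LM; exact: OK_int. Qed.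

Lemma pidE c : pid c = scal c OK. Proof. by []. Qed.

Lemma OKmod_OK : OKmod OK.
Proof. by split; [exact: OK0|exact: OKB|exact: OKM]. Qed.

Lemma OKmod_scal c L : OKmod L -> OKmod (scal c L).
Proof.
move=> [L0 LB LM]; split.
- by exists 0 => //; rewrite mulr0.
- by move=> _ _ [x Lx <-] [y Ly <-]; exists (x - y); [exact: LB|rewrite mulrBr].
- by move=> a _ ha [x Lx <-]; exists (a * x); [exact: LM|rewrite mulrCA].
Qed.

Lemma OKmod_pid c : OKmod (pid c).
Proof. exact/OKmod_scal/OKmod_OK. Qed.

Lemma OKmod_conjs L : OKmod L -> OKmod (conjs L).
Proof.
move=> [L0 LB LM]; split.
- by exists 0 => //; rewrite conjc0.
- by move=> _ _ [x Lx <-] [y Ly <-]; exists (x - y); [exact: LB|rewrite conjcB].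
- move=> a _ ha [x Lx <-]; exists (a^* * x); last by rewrite conjcM conjcK.
  by apply: LM => //; exact: OK_conjc.
Qed.

Lemma OKmod_idmul I J : OKmod I -> OKmod (idmul I J).
Proof.
move=> hI; have hM a x : OK a -> idmul I J x -> idmul I J (a * x).
  move=> ha; move: x; apply: (@idmul_ind _ [set x | idmul I J (a * x)]) => [|x y|x y Ix Jy] /=.
  - by rewrite mulr0; exact: idmul0.
  - by rewrite mulrDr; exact: idmulD.
  - by rewrite mulrA; apply: idmul_mem => //; case: hI => _ _; exact.
split=> //; first exact: idmul0.
move=> x y hx hy; apply: idmulD => //; rewrite -mulN1r; apply: hM => //.
by rewrite -[-1]/((-1)%:~R); exact: OK_int.
Qed.

Lemma idmul_OK L : OKmod L -> idmul L OK = L.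
Proof.
move=> hL; apply/seteqP; split.
  apply: (@idmul_ind _ L); [by case: hL|by move=> *; exact: OKmodD|].
  by move=> x y Lx oy; rewrite mulrC; case: hL => _ _; exact.
by move=> x Lx; rewrite -[x]mulr1; apply: idmul_mem => //; exact: OK1.
Qed.

Lemma idmul_pid c L : OKmod L -> idmul L (pid c) = scal c L.
Proof. by move=> hL; rewrite pidE idmul_scalr idmul_OK. Qed.

Lemma pid_scal c d : scal c (pid d) = pid (c * d).
Proof. exact: scalA. Qed.

Lemma pid_idmul c d : idmul (pid c) (pid d) = pid (c * d).
Proof. by rewrite idmul_pid ?pid_scal 1?mulrC//; exact: OKmod_pid. Qed.

Lemma pid_mem c : pid c c.
Proof. by exists 1; [exact: OK1|rewrite mulr1]. Qed.

Lemma pid_sub c L : OKmod L -> L c -> pid c `<=` L.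
Proof. by move=> [_ _ LM] Lc _ [a oa <-]; rewrite mulrC; exact: LM. Qed.

(** The norms of [u] and [u^-1] are natural numbers with product 1. *)
Lemma norm_unit_OK u : OK u -> OK u^-1 -> u != 0 -> u * u^* = 1.
Proof.
move=> /OK_norm -/(_ hD) [n hn] /OK_norm -/(_ hD) [k hk] u0.
have := congr2 *%R hn hk; rewrite conjc_inv mulrACA divff// divff ?conjc_eq0// mulr1.
rewrite -natrM => /esym/eqP; rewrite -[1]/(1%:R) eqr_nat muln_eq1 => /andP[/eqP n1 _].
by rewrite hn n1.
Qed.

Lemma pid_eqP c d : c != 0 -> pid c = pid d -> [/\ d != 0, OK (d / c) & OK (c / d)].
Proof.
move=> c0 e.
have d0 : d != 0.
  apply: contra_neq c0 => d0; have := pid_mem c; rewrite e d0 => -[y _ <-].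
  by rewrite mul0r.
split=> //.
  by have := pid_mem d; rewrite -e pidE => /(scalE _ _ c0).
by have := pid_mem c; rewrite e pidE => /(scalE _ _ d0).
Qed.

Lemma pid_eq_norm c d : c != 0 -> pid c = pid d -> c * c^* = d * d^*.
Proof.
move=> c0 /pid_eqP -/(_ c0) [d0 o1 o2].
have h : (d / c) * (d / c)^* = 1.
  by apply: norm_unit_OK; rewrite ?invf_div// mulf_neq0// invr_eq0.
have c1 : c^* != 0 by rewrite conjc_eq0.
move: h; rewrite conjcM conjc_inv mulrACA -invfM => /(canRL (mulfVK _)).
by rewrite mulf_neq0// mul1r => ->.
Qed.

Lemma pid_pos_inj c d : 0 < c -> 0 < d -> pid c = pid d -> c = d.
Proof.
move=> c0 d0 /pid_eq_norm -/(_ (lt0r_neq0 c0)).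
rewrite !conjc_ge0 ?ltW// -!expr2 => /eqP.
by rewrite eqrXn2 ?ltW// => /eqP.
Qed.

Lemma rel_norm_unique L c d : rel_norm L c -> rel_norm L d -> c = d.
Proof. by move=> [_ c0 hc] [_ d0 hd]; apply: pid_pos_inj => //; rewrite -hc -hd. Qed.

Lemma rel_norm_idmul I J c d : rel_norm I c -> rel_norm J d -> rel_norm (idmul I J) (c * d).
Proof.
move=> [hI c0 hc] [hJ d0 hd]; split; [exact: OKmod_idmul|exact: mulr_gt0|].
rewrite conjs_idmul idmulA -(idmulA I) (idmulC J) (idmulA I) hc -idmulA hd.
exact: pid_idmul.
Qed.

Lemma rel_norm_scal L c d : d != 0 -> rel_norm L c -> rel_norm (scal d L) (d * d^* * c).
Proof.
move=> d0 [hL c0 hc]; split; first exact: OKmod_scal.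
  by rewrite mulr_gt0// mul_conjc_gt0.
by rewrite conjs_scal idmul_scal idmul_scalr scalA hc pid_scal.
Qed.

Lemma rel_norm_conjs L c : rel_norm L c -> rel_norm (conjs L) c.
Proof.
move=> [hL c0 hc]; split; [exact: OKmod_conjs|done|].
by rewrite conjsK idmulC hc.
Qed.

(** In other words [conj L / c] is the inverse of [L]; factors are cancelled this way throughout. *)
Lemma idmul_conjsl L c I : rel_norm L c -> OKmod I -> idmul (conjs L) (idmul L I) = scal c I.
Proof.
by move=> [hL c0 hc] hI; rewrite idmulA (idmulC _ L) hc idmulC idmul_pid.
Qed.

(** If [x L] lies in [L], multiplying by [conj L] shows that [x c] lies in [c O_K]. *)
Lemma rel_norm_End L c : rel_norm L c -> latt_End L = OK.
Proof.
move=> [hL c0 hc]; apply/seteqP; split => x; last first.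
  by move=> ox y Ly; case: hL => _ _; exact.
move=> hx; have c0' := lt0r_neq0 c0.
have hs : idmul L (conjs L) `<=` [set y | pid c (x * y)].
  apply: (@idmul_ind _ [set y | pid c (x * y)]) => [|u v|u v Lu Lv] /=.
  - by rewrite mulr0; case: (OKmod_pid c).
  - by rewrite mulrDr; apply: OKmodD; exact: OKmod_pid.
  - by rewrite mulrA -hc; apply: idmul_mem => //; exact: hx.
have : pid c (x * c) by apply: hs; rewrite hc; exact: pid_mem.
by rewrite pidE => /(scalE _ _ c0'); rewrite mulfK.
Qed.

End Modules.

(** * Lattices with complex multiplication *)

(** Certificates for equations that follow from hypotheses: [k] and [k'] are the multipliers, and
    [ring] checks the remaining identity. *)
Lemma lincomb1 (V : comNzRingType) (k l r a b : V) :
  l = r -> a - b = k * (l - r) -> a = b.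
Proof. by move=> ->; rewrite subrr mulr0 => /subr0_eq. Qed.

Lemma lincomb2 (V : comNzRingType) (k l r k' l' r' a b : V) :
  l = r -> l' = r' -> a - b = k * (l - r) + k' * (l' - r') -> a = b.
Proof. by move=> -> ->; rewrite !subrr !mulr0 addr0 => /subr0_eq. Qed.

Lemma Bezout3 (a b c : int) : gcdz (gcdz a b) c = 1 ->
  exists u v t : int, u * a + v * b + t * c = 1.
Proof.
move=> h; have [u [v e1]] := Bezoutz a b; have [s [t e2]] := Bezoutz (gcdz a b) c.
exists (s * u), (s * v), t; rewrite -h -e2 -e1; ring.
Qed.

Lemma primitive_multiple (a b c : int) : a != 0 ->
  exists g a' b' c' : int, [/\ g != 0, 0 < a', gcdz (gcdz a' b') c' = 1 &
    [/\ a = g * a', b = g * b' & c = g * c']].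
Proof.
move=> a0; set g := gcdz (gcdz a b) c.
have ga : (g %| a)%Z by rewrite (dvdz_trans (dvdz_gcdl _ _))// dvdz_gcdl.
have gb : (g %| b)%Z by rewrite (dvdz_trans (dvdz_gcdl _ _))// dvdz_gcdr.
have gc : (g %| c)%Z by rewrite dvdz_gcdr.
have g0 : g != 0 by apply: contraNneq a0 => g0; rewrite -dvd0z -g0.
(* [s] is the sign that makes the leading coefficient positive. *)
have [s ss e] : exists2 s : int, s * s = 1 & a * s * g > 0.
  have [h|h] := ltP 0 (a * g); first by exists 1 => //; rewrite mulr1.
  exists (-1) => //; rewrite mulrN1 mulNr oppr_gt0 lt_neqAle h andbT.
  by rewrite mulf_neq0.
case/dvdzP: ga => a1 ea; case/dvdzP: gb => b1 eb; case/dvdzP: gc => c1 ec.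
have [u [v [t huv]]] : exists u v t, u * a1 + v * b1 + t * c1 = 1.
  have [u [v e1]] := Bezoutz a b; have [x [y e2]] := Bezoutz (gcdz a b) c.
  exists (x * u), (x * v), y; apply: (mulIf g0); rewrite mul1r.
  rewrite -/g -e1 in e2; rewrite -[RHS]e2 ea eb ec; ring.
exists (g * s), (a1 * s), (b1 * s), (c1 * s); split.
- by rewrite mulf_neq0//; apply: contra_eq_neq ss => ->.
- have : 0 < a1 * s * (g * g) by move: e; rewrite ea; congr (0 < _); ring.
  by rewrite pmulr_lgt0// -expr2 lt_def sqr_ge0 andbT expf_neq0.
- set d := gcdz _ _.
  have h1 : (d %| a1 * s)%Z by rewrite (dvdz_trans (dvdz_gcdl _ _))// dvdz_gcdl.
  have h2 : (d %| b1 * s)%Z by rewrite (dvdz_trans (dvdz_gcdl _ _))// dvdz_gcdr.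
  have h3 : (d %| c1 * s)%Z by rewrite dvdz_gcdr.
  have hx x : x = x * s * s by rewrite -mulrA ss mulr1.
  have : (d %| u * a1 + v * b1 + t * c1)%Z.
    by rewrite (hx a1) (hx b1) (hx c1); apply: rpredD; [apply: rpredD|];
      apply: dvdz_mull; apply: dvdz_mulr.
  rewrite huv dvdz1 => /eqP hd; have -> : d = Posz (absz d) by [].
  by rewrite hd.
- by split; rewrite mulrACA ss mulr1 mulrC.
Qed.

Section Lattices.
Variables (R : realType) (D : int).
Hypothesis hD : neg_fund_disc D.
Local Notation C := R[i].
Local Notation OK := (@Defs.OK R D).
Local Notation pid := (@Defs.pid R D).
Local Notation OKmod := (@OKmod R D).
Local Notation rel_norm := (@rel_norm R D).
Local Notation w := (omega R D).
Local Notation delta := (sqrtD R D).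
Implicit Types (x y c d z : C) (I J K L M : set C).

Let D0 : D < 0. Proof. by case: hD. Qed.

Lemma Im_eq0 z : complex.Im z = 0 <-> z^* = z.
Proof.
case: z => a b /=; split => [->|[/eqP]]; first by rewrite oppr0.
by rewrite eqNr => /eqP.
Qed.

Lemma latt_scal (w1 w2 : C) : w1 != 0 -> latt w1 w2 = scal w1 (latt 1 (w2 / w1)).
Proof.
move=> h; apply/seteqP; split => x.
  move=> [m [n ->]]; exists (m%:~R + n%:~R * (w2 / w1)).
    by exists m, n; rewrite mulr1.
  by rewrite /ofZ; field.
move=> [_ [m [n ->]] <-]; exists m, n; rewrite /ofZ; by field.
Qed.

Section Form.
Variables (z : C) (A B Cc : int).
Hypotheses (hz : complex.Im z != 0) (hgcd : gcdz (gcdz A B) Cc = 1)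
  (hroot : A%:~R * z ^+ 2 + B%:~R * z + Cc%:~R = 0)
  (hst : OKmod (latt 1 z)).

(* [D] is a square times the discriminant of the form, and [D] is fundamental. *)
Lemma form_disc : B * B - 4 * A * Cc = D /\
  (delta = 2 * A%:~R * z + B%:~R \/ delta = - (2 * A%:~R * z + B%:~R)).
Proof.
have l1 : latt 1 z 1 by exists 1, 0; rewrite /ofZ mul0r addr0 mul1r.
have lz : latt 1 z z by exists 0, 1; rewrite /ofZ mul0r add0r mul1r.
case: hst => _ _ hM.
have [x [y]] := hM _ _ (OK_omega R D) l1; rewrite /ofZ !mulr1 => ew.
have [u [v]] := hM _ _ (OK_omega R D) lz; rewrite /ofZ !mulr1 => ewz.
have y0 : y != 0.
  apply: contra_neq (Im_omega_neq0 R hD) => y0.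
  by rewrite ew Im_int_comb y0 mul0r.
(* Eliminating [z^2] between [omega z = u + v z] and the form leaves an integral relation between 1
   and [z], which must be trivial. *)
have [e1 e2] : A * u + y * Cc = 0 /\ y * B - A * (x - v) = 0.
  apply: (int_comb_eq0 hz).
  rewrite !(intrD, intrB, intrM, mulrNz); rewrite ew in ewz.
  by apply: (lincomb2 (k := y%:~R) (k' := - A%:~R) hroot ewz); ring.
have [a [b [c habc]]] := Bezout3 hgcd.
(* The vector [(y, x - v, - u)] is proportional to [(A, B, Cc)]; primitivity makes the factor [n] an
   integer. *)
have [n yn] : exists n, y = A * n.
  exists (y * a + b * (x - v) - c * u); rewrite -[LHS]mulr1 -habc.
  have -> : y * (a * A + b * B + c * Cc) = A * (y * a) + b * (y * B) + c * (y * Cc) by ring.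
  have -> : y * B = A * (x - v) by apply/eqP; rewrite -subr_eq0 e2.
  have -> : y * Cc = - (A * u) by apply/eqP; rewrite -addr_eq0 addrC e1.
  ring.
have A0 : A != 0 by apply: contra_neq y0 => A0; rewrite yn A0 mul0r.
have n0 : n != 0 by apply: contra_neq y0 => A0'; rewrite yn A0' mulr0.
have [Q hQ] : exists Q, Q = B * B - 4 * A * Cc by eexists.
set th := 2 * A%:~R * z + B%:~R : C.
have thQ : th * th = Q%:~R.
  rewrite hQ !(intrB, intrM) /th.
  by apply: (lincomb1 (k := 4 * A%:~R) hroot); ring.
have [k edl] : exists k : int, delta = k%:~R + n%:~R * th.
  exists (2 * x - n * B - D); have h := omega2E R D; rewrite ew yn in h.
  rewrite /th !(intrB, intrM).
  rewrite intrM in h.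
  by apply: (lincomb1 (k := -1) h); ring.
have h2 := sqrtD_sqr R D0.
(* Squaring [delta = k + n th] gives [D = k^2 + n^2 Q + 2 k n th], so the term in [th] vanishes and
   [k = 0]. *)
have : (k * k + n * n * Q - D + 2 * k * n * B)%:~R + (4 * k * n * A)%:~R * z = 0 :> C.
  rewrite !(intrD, intrB, intrM); rewrite edl in h2.
  by apply: (lincomb2 (k := 1) (k' := - (n%:~R * n%:~R)) h2 thQ); rewrite /th; ring.
move=> /(int_comb_eq0 hz) [_ /eqP]; rewrite !mulf_eq0 (negPf A0) (negPf n0) !orbF /= => /eqP k0.
have DQ : D = n * n * Q.
  apply: (@intr_inj C); rewrite -h2 edl k0 add0r !intrM -thQ; ring.
have : n = 1 \/ n = -1.
  apply: (fund_disc_square_factor hD DQ).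
  have eB := divz_eq B 2; set p := (B %/ 2)%Z in eB.
  have : (B %% 2)%Z = 0 \/ (B %% 2)%Z = 1 by lia.
  case=> h; rewrite h in eB; rewrite hQ eB.
    exists (p * p - A * Cc); left; ring.
  exists (p * p + p - A * Cc); right; ring.
rewrite k0 add0r in edl.
case=> ne; split; try by rewrite -hQ [RHS]DQ ne; ring.
  by left; rewrite edl ne mul1r.
by right; rewrite edl ne mulN1r.
Qed.

(** Vieta's formulas; the sum of the roots is read off from [delta + conj delta = 0], and the
    product then follows from the equation of [z]. *)
Lemma form_trace : 0 < A -> z + z^* = - B%:~R / A%:~R /\ z * z^* = Cc%:~R / A%:~R.
Proof.
move=> A0; have A0' : (A%:~R : C) != 0 by rewrite intr_eq0 gt_eqF.
have [_ hdl] := form_disc.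
have e : A%:~R * (z + z^*) = - B%:~R.
  have hc : delta + delta^* = 0 by rewrite conjc_sqrtD subrr.
  apply: (@mulfI _ (2 : C)); first by rewrite pnatr_eq0.
  have cc : (2 * A%:~R * z + B%:~R)^* = 2 * A%:~R * z^* + B%:~R.
    by rewrite conjcD !conjcM conjc_nat !conjc_int.
  move: hc; case: hdl => ->; rewrite ?conjcN cc => hc.
    by apply: (lincomb1 (k := 1) hc); ring.
  by apply: (lincomb1 (k := -1) hc); ring.
split; apply: (mulfI A0'); rewrite [RHS]mulrCA divff// mulr1//.
have -> : z^* = - B%:~R / A%:~R - z by rewrite -e; field.
have -> : A%:~R * (z * (- B%:~R / A%:~R - z)) = - B%:~R * z - A%:~R * z ^+ 2 by field.
by apply: (lincomb1 (k := -1) hroot); ring.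
Qed.

Lemma rel_norm_form : 0 < A -> rel_norm (latt 1 z) (A%:~R)^-1.
Proof.
move=> A0; have A0' : (A%:~R : C) != 0 by rewrite intr_eq0 gt_eqF.
have [hQ hdl] := form_disc; have [ht hn] := form_trace A0.
split=> //; first by rewrite invr_gt0 ltr0z.
have oAz : OK (A%:~R * z).
  (* [A z] is [(- B + delta) / 2] or [(- B - delta) / 2], and is integral because
     [D = B * B - 4 A Cc] has the parity of [B]. *)
  have [q hq] : exists q : int, B + D = 2 * q.
    exists (((B + B * B)%R %/ 2)%Z - 2 * A * Cc); rewrite -hQ.
    suff : (2 %| B + B * B)%Z by case/dvdzP => t e; rewrite e mulzK//; apply: (lincomb1 (k := 1) e); ring.
    have eB := divz_eq B 2; have : (B %% 2)%Z = 0 \/ (B %% 2)%Z = 1 by lia.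
    set p := (B %/ 2)%Z in eB; move: eB; clearbody p => eB.
    case=> h; rewrite h in eB; apply/dvdzP; [exists (p + 2 * p * p)|exists (2 * p * p + 3 * p + 1)];
      rewrite eB; ring.
  have hq' : (2 : C) * q%:~R = B%:~R + D%:~R by rewrite -intrD hq intrM.
  have hw := omega2E R D.
  have t0 : (2 : C) != 0 by rewrite pnatr_eq0.
  case: hdl => h; [exists (- q), 1|exists (D - q), (-1)];
    rewrite /ofZ ?intrB ?mulrNz; apply: (mulfI t0); rewrite h in hw.
    by apply: (lincomb2 (k := 1) (k' := -1) hq' hw); ring.
  by apply: (lincomb2 (k := 1) (k' := 1) hq' hw); ring.
have oAzc : OK (A%:~R * z^*) by rewrite -(conjc_int R A) -conjcM; exact: OK_conjc.
apply/seteqP; split.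
  apply: (@idmul_ind _ (pid (A%:~R)^-1)).
  - by case: (OKmod_pid hD (A%:~R : C)^-1).
  - by move=> x y; apply: OKmodD; exact: OKmod_pid.
  - move=> _ _ [m [n ->]] [_ [m' [n' ->]] <-]; rewrite /ofZ.
    rewrite pidE; apply/scalE; first by rewrite invr_eq0.
    rewrite invrK conjcD !conjcM !conjc_int conjc1.
    have -> : (m%:~R * 1 + n%:~R * z) * (m'%:~R * 1 + n'%:~R * z^*) * A%:~R =
      (A * m * m' + n * n' * Cc)%:~R + (m * n')%:~R * (A%:~R * z^*) + (n * m')%:~R * (A%:~R * z).
      rewrite !(intrD, intrM).
      have hn' : A%:~R * (z * z^*) = Cc%:~R by rewrite hn mulrCA divff// mulr1.
      by apply: (lincomb1 (k := n%:~R * n'%:~R) hn'); ring.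
    by apply: OKD; [apply: OKD|]; rewrite -1?intrM; (exact: OK_int || (apply: (OKM hD) => //; exact: OK_int)).
have hI : OKmod (idmul (latt 1 z) (conjs (latt 1 z))) by exact: OKmod_idmul.
apply: pid_sub => //.
have l1 : latt 1 z 1 by exists 1, 0; rewrite /ofZ mul0r addr0 mul1r.
have lz : latt 1 z z by exists 0, 1; rewrite /ofZ mul0r add0r mul1r.
have c1 : conjs (latt 1 z) 1 by exists 1 => //; rewrite conjc1.
have cz : conjs (latt 1 z) z^* by exists z.
have [a [b [c habc]]] := Bezout3 hgcd.
have habc' : a%:~R * A%:~R + b%:~R * B%:~R + c%:~R * Cc%:~R = 1 :> C.
  by rewrite -!(intrM, intrD) habc.
have -> : (A%:~R)^-1 = a%:~R * (1 * 1) - b%:~R * (z * 1 + 1 * z^*) + c%:~R * (z * z^*).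
  rewrite !mulr1 mul1r ht hn.
  transitivity ((a%:~R * A%:~R + b%:~R * B%:~R + c%:~R * Cc%:~R) / A%:~R : C).
    by rewrite habc' mul1r.
  by field.
apply: (OKmodD hI); last by apply: (OKmodMz _ hI); exact: idmul_mem.
apply: (OKmodD hI); first by apply: (OKmodMz _ hI); exact: idmul_mem.
by apply: (OKmodN hI); apply: (OKmodMz _ hI); apply: idmulD; exact: idmul_mem.
Qed.

End Form.

Lemma form_exists z : complex.Im z != 0 -> OKmod (latt 1 z) ->
  exists A B Cc : int, [/\ gcdz (gcdz A B) Cc = 1, 0 < A &
    A%:~R * z ^+ 2 + B%:~R * z + Cc%:~R = 0].
Proof.
move=> hz [_ _ hM].
have l1 : latt 1 z 1 by exists 1, 0; rewrite /ofZ mul0r addr0 mul1r.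
have lz : latt 1 z z by exists 0, 1; rewrite /ofZ mul0r add0r mul1r.
have [x [y]] := hM _ _ (OK_omega R D) l1; rewrite /ofZ !mulr1 => ew.
have [u [v]] := hM _ _ (OK_omega R D) lz; rewrite /ofZ !mulr1 => ewz.
have y0 : y != 0.
  apply: contra_neq (Im_omega_neq0 R hD) => y0.
  by rewrite ew Im_int_comb y0 mul0r.
have [g [A [B [Cc [g0 A0 hg [e1 e2 e3]]]]]] := primitive_multiple (x - v) (- u) y0.
exists A, B, Cc; split=> //.
have g0' : (g%:~R : C) != 0 by rewrite intr_eq0.
apply: (mulfI g0'); rewrite mulr0 !mulrDr !mulrA -!intrM -e1 -e2 -e3 intrB mulrNz.
by rewrite ew in ewz; apply: (lincomb1 (k := 1) ewz); ring.
Qed.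

Lemma latt_rel_norm (w1 w2 : C) : w1 != 0 -> complex.Im (w2 / w1) != 0 -> OKmod (latt w1 w2) ->
  exists (A B Cc : int) (rho : C), [/\ gcdz (gcdz A B) Cc = 1, rel_norm (latt w1 w2) rho,
    forall m n : int, (m%:~R * w1 + n%:~R * w2) * (m%:~R * w1 + n%:~R * w2)^* =
      rho * (A * m * m - B * m * n + Cc * n * n)%:~R &
    w2 * w1^* - w2^* * w1 = rho * delta \/ w2 * w1^* - w2^* * w1 = - (rho * delta)].
Proof.
move=> h1 + hL; set z := w2 / w1 => hz.
have w2E : w2 = w1 * z by rewrite mulrCA divff// mulr1.
have hL' : OKmod (latt 1 z).
  have -> : latt 1 z = scal w1^-1 (latt w1 w2) by rewrite (latt_scal _ h1) scalA mulVf// scal1.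
  exact: OKmod_scal.
have [A [B [Cc [hg A0 hr]]]] := form_exists hz hL'.
have A0' : (A%:~R : C) != 0 by rewrite intr_eq0 gt_eqF.
have [ht hn] := form_trace hz hg hr hL' A0.
have [_ hdl] := form_disc hz hg hr hL'.
have hnm : rel_norm (latt w1 w2) (w1 * w1^* * (A%:~R)^-1).
  rewrite (latt_scal _ h1); by apply: rel_norm_scal => //; exact: (rel_norm_form hz hg hr hL' A0).
clearbody z.
exists A, B, Cc, (w1 * w1^* * (A%:~R)^-1); split=> //.
- move=> m n; rewrite w2E conjcD !conjcM !conjc_int !(intrD, intrB, intrM).
  have -> : (m%:~R * w1 + n%:~R * (w1 * z)) * (m%:~R * w1^* + n%:~R * (w1^* * z^*)) =
    w1 * w1^* * (m%:~R * m%:~R + m%:~R * n%:~R * (z + z^*) + n%:~R * n%:~R * (z * z^*)) by ring.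
  by rewrite ht hn; field.
- have e : w2 * w1^* - w2^* * w1 = w1 * w1^* * (z - z^*) by rewrite w2E conjcM; ring.
  have e2 : z - z^* = (2 * A%:~R * z + B%:~R) / A%:~R.
    have -> : z - z^* = 2 * z - (z + z^*) by ring.
    by rewrite ht; field.
  by rewrite e e2; case: hdl => ->; [left|right]; field.
Qed.

End Lattices.

(** * Ideals and ideal classes *)

Lemma subgroup_int (H : int -> Prop) : (forall m n, H m -> H n -> H (m - n)) ->
  (exists2 m, H m & m != 0) ->
  exists2 g, 0 < g & forall m, H m <-> exists a, m = a * g.
Proof.
move=> HB [m0 Hm0 m00].
have H0 : H 0 by rewrite -(subrr m0); exact: HB.
have HN m : H m -> H (- m) by move=> hm; rewrite -sub0r; exact: HB.
have HM m (k : nat) : H m -> H (k%:Z * m).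
  move=> hm; elim: k => [|k ih]; first by rewrite mul0r.
  have -> : k.+1%:Z * m = k%:Z * m - - m by rewrite -addn1 PoszD; ring.
  by apply: HB => //; exact: HN.
have HMz m a : H m -> H (a * m).
  move=> hm; case: (intP a) => [|k|k]; [by rewrite mul0r|exact: HM|].
  by rewrite mulNr; apply/HN/HM.
have ex : exists k : nat, (0 < k)%N && `[< H k%:Z >].
  exists (absz m0); rewrite absz_gt0 m00/=; apply/asboolP.
  by have [h|h] := leP 0 m0; [rewrite gez0_abs|rewrite ltz0_abs//; exact: HN].
case: (ex_minnP ex) => g /andP[g0 /asboolP Hg] gmin.
exists g%:Z => // m; split; last by case=> a ->; exact: HMz.
move=> Hm; exists (m %/ g)%Z.
have e := divz_eq m g.
have hr : H (m %% g)%Z.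
  have -> : (m %% g)%Z = m - (m %/ g)%Z * g%:Z by rewrite {2}e; ring.
  by apply: HB => //; exact: HMz.
suff r0 : (m %% g)%Z = 0 by rewrite {1}e r0 addr0.
have r1 : 0 <= (m %% g)%Z by rewrite modz_ge0//; lia.
have r2 : (m %% g)%Z < g%:Z by rewrite ltz_pmod//; lia.
case E : (m %% g)%Z r1 r2 hr => [[|r]|r] //= _ r2 hr.
have := gmin r.+1; rewrite /= (asboolT hr) => /(_ isT); lia.
Qed.

Lemma dvdn_prod_primes (p N : nat) (P : pred nat) : prime p -> p \in primes N ->
  (p %| \prod_(q <- primes N | P q) q)%N = P p.
Proof.
move=> pp pN; case Pp : (P p).
  by rewrite (big_rem p)//= Pp dvdn_mulr.
rewrite Euclid_dvd_prod// big_seq_cond big_has_cond; apply/negbTE/hasPn => q qN.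
apply/negP => /andP[/andP[_ Pq]].
rewrite dvdn_prime2// => [/eqP e|]; first by rewrite -e Pp in Pq.
by move: qN; rewrite mem_primes => /andP[].
Qed.

(** [m] and [n] are chosen so that modulo each prime [p] of [N] a single term survives: [A m^2] if
    [p] does not divide [A], [Cc n^2] if it divides [A] but not [Cc], and [B m n] if it divides
    both, in which case primitivity keeps [p] away from [B]. *)
Lemma primitive_form_coprime (A B Cc : int) (N : nat) : (0 < N)%N ->
  gcdz (gcdz A B) Cc = 1 ->
  exists m n : int, coprime (absz (A * m * m - B * m * n + Cc * n * n)) N.
Proof.
move=> N0 hg.
pose m := \prod_(p <- primes N | (p %| absz A)%N && ~~ (p %| absz Cc)%N) p.
pose n := \prod_(p <- primes N | ~~ (p %| absz A)%N) p.
exists m%:Z, n%:Z; rewrite /coprime; set v := absz _.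
apply: contraT => h1.
have g0 : (0 < gcdn v N)%N by rewrite gcdn_gt0 N0 orbT.
have g1 : (1 < gcdn v N)%N by rewrite ltn_neqAle eq_sym h1.
have pp := pdiv_prime g1; have pd := pdiv_dvd (gcdn v N).
set p := pdiv _ in pp pd.
have pN : p \in primes N by rewrite mem_primes pp N0 (dvdn_trans pd)// dvdn_gcdr.
have pv : (p %| v)%N by rewrite (dvdn_trans pd)// dvdn_gcdl.
have hm : (p %| m)%N = (p %| absz A)%N && ~~ (p %| absz Cc)%N by rewrite dvdn_prod_primes.
have hn : (p %| n)%N = ~~ (p %| absz A)%N by rewrite dvdn_prod_primes.
have Ez (x y : int) : (p%:Z %| x * y)%Z = (p%:Z %| x)%Z || (p%:Z %| y)%Z.
  by rewrite !dvdzE/= abszM Euclid_dvdM.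
have pv' : (p%:Z %| A * m%:Z * m%:Z - B * m%:Z * n%:Z + Cc * n%:Z * n%:Z)%Z by rewrite dvdzE.
have hm' : (p%:Z %| m%:Z)%Z = (p%:Z %| A)%Z && ~~ (p%:Z %| Cc)%Z by rewrite !dvdzE.
have hn' : (p%:Z %| n%:Z)%Z = ~~ (p%:Z %| A)%Z by rewrite !dvdzE.
case pA : (p%:Z %| A)%Z hm' hn' => /= hm' hn'; last first.
  move: pv'; rewrite rpredDr; last by rewrite !Ez hn' orbT.
  by rewrite rpredBr ?Ez ?hn' ?orbT// hm' pA.
case pC : (p%:Z %| Cc)%Z hm' => /= hm'; last first.
  move: pv'; rewrite rpredDl ?Ez ?hn' ?pC//.
  by rewrite rpredB// !Ez hm' ?orbT.
move: pv'; rewrite rpredDr ?Ez ?pC// rpredBl ?Ez ?pA// hm' hn' !orbF => pB.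
have : (p%:Z %| 1)%Z.
  have [u [v' [t e]]] := Bezout3 hg.
  by rewrite -[1%Z]/(1 : int) -e; apply: rpredD; [apply: rpredD|]; rewrite Ez ?pA ?pB ?pC orbT.
by rewrite dvdz1 /= => /eqP p1; move: pp; rewrite p1.
Qed.

Section Ideals.
Variables (R : realType) (D : int).
Hypothesis hD : neg_fund_disc D.
Local Notation C := R[i].
Local Notation OK := (@Defs.OK R D).
Local Notation pid := (@Defs.pid R D).
Local Notation OKmod := (@OKmod R D).
Local Notation rel_norm := (@rel_norm R D).
Local Notation is_ideal := (@is_ideal R D).
Local Notation ideal_norm := (@ideal_norm R D).
Local Notation w := (omega R D).
Local Notation delta := (sqrtD R D).
Implicit Types (x y c d z : C) (I J K L M : set C).

Let D0 : D < 0. Proof. by case: hD. Qed.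

Lemma is_idealP I : is_ideal I <-> [/\ I `<=` OK, OKmod I & exists2 x, I x & x != 0].
Proof.
split; first by move=> [? [? [[x [? ?]] [? ?]]]]; split=> //; exists x.
by move=> [? [? ? ?] [x ? ?]]; do ?split => //; exists x.
Qed.

Lemma is_ideal_OK : is_ideal OK.
Proof.
by apply/is_idealP; split=> //; [exact: OKmod_OK|exists 1; [exact: OK1|exact: oner_neq0]].
Qed.

Lemma is_ideal_conjs I : is_ideal I -> is_ideal (conjs I).
Proof.
move=> /is_idealP [sI hI [x Ix x0]]; apply/is_idealP; split.
- by move=> _ [y /sI oy <-]; exact: OK_conjc.
- exact: OKmod_conjs.
- by exists x^*; [exists x|rewrite conjc_eq0].
Qed.

Lemma is_ideal_idmul I J : is_ideal I -> is_ideal J -> is_ideal (idmul I J).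
Proof.
move=> /is_idealP [sI hI [x Ix x0]] /is_idealP [sJ hJ [y Jy y0]]; apply/is_idealP; split.
- apply: (@idmul_ind _ OK); [exact: OK0|by move=> *; exact: OKD|].
  by move=> u v /sI ou /sJ ov; exact: OKM.
- exact: OKmod_idmul.
- by exists (x * y); [exact: idmul_mem|rewrite mulf_neq0].
Qed.

(** Hermite normal form: [g] generates the rational integers in [I], [t] the [omega]-coordinates of
    its elements. Both are nonzero because [I] contains the norm [k] of one of its nonzero
    elements. *)
Lemma ideal_basis I : is_ideal I -> exists n, ideal_norm I n.
Proof.
move=> /is_idealP [sI hI [x Ix x0]].
have [IZ IB IM] := hI.
have nx : x * x^* != 0 by rewrite mulf_neq0// conjc_eq0.
have [k hk] := OK_norm hD (sI _ Ix).
have k0 : k != 0%N by apply: contra_neq nx => k0; rewrite hk k0.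
have Ik : I k%:R by rewrite -hk mulrC; apply: IM => //; apply: OK_conjc => //; exact: sI.
pose G (m n : int) := I (m%:~R + n%:~R * w).
have GB m n m' n' : G m n -> G m' n' -> G (m - m') (n - n').
  move=> h1 h2; have := IB _ _ h1 h2; rewrite /G !intrB; congr I; ring.
have [g g0 hg] : exists2 g : int, 0 < g & forall m, G m 0 <-> exists a, m = a * g.
  apply: subgroup_int; first by move=> m n h1 h2; rewrite -(subrr 0); exact: GB.
  by exists k%:Z; rewrite // /G mul0r addr0.
have [t t0 ht] : exists2 t : int, 0 < t & forall n, (exists m, G m n) <-> exists a, n = a * t.
  apply: subgroup_int.
    by move=> m n [m' h1] [n' h2]; exists (m' - n'); exact: GB.
  exists k%:Z => //; exists 0; rewrite /G add0r mulrC; apply: IM => //; exact: OK_omega.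
have [p hp] : exists p, G p t by apply/ht; exists 1; rewrite mul1r.
exists (absz (g * t - 0 * p)%R), g, 0, p, t; split=> //.
apply/seteqP; split => y; rewrite /mkset /ofZ.
  move=> Iy; have [m [n yE]] := sI _ Iy.
  have hG : G m n by rewrite /G -yE.
  have [b nE] : exists a, n = a * t by apply/ht; exists m.
  have [a mE] : exists a, m - b * p = a * g.
    apply/hg; have := OKmodMz b hI hp; rewrite /G => h.
    have := IB _ _ hG h; congr I; rewrite nE intrB !intrM; ring.
  exists a, b; rewrite yE /ofZ nE.
  have -> : m = a * g + b * p by rewrite -mE subrK.
  rewrite intrD !intrM; ring.
move=> [a [b ->]]; apply: (OKmodD hI); apply: (OKmodMz _ hI) => //.
by apply/(hg g); exists 1; rewrite mul1r.
Qed.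

(** [x] and [omega x] both lie in [I] and have determinant [delta |x|^2], so the basis cannot be
    degenerate. *)
Lemma ideal_latt_det I (p q s t : int) : is_ideal I ->
  I = latt (p%:~R + q%:~R * w) (s%:~R + t%:~R * w) ->
  [/\ p%:~R + q%:~R * w != 0 & complex.Im ((s%:~R + t%:~R * w) / (p%:~R + q%:~R * w)) != 0].
Proof.
move=> /is_idealP [_ [_ _ IM] [x Ix x0]].
set w1 := p%:~R + _; set w2 := s%:~R + _ => IE; clearbody w1 w2.
have dl0 := sqrtD_neq0 R D0.
have h : w2 * w1^* - w2^* * w1 != 0.
  have := IM _ _ (OK_omega R D) Ix; move: Ix; rewrite IE.
  move=> [m [n]]; rewrite /ofZ => xE [m' [n']]; rewrite /ofZ => wxE.
  have : delta * (x * x^*) != 0 by rewrite !mulf_neq0// conjc_eq0.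
  apply: contra_neq => e.
  have -> : delta * (x * x^*) = (w * x) * x^* - (w * x)^* * x.
    rewrite -(omega_sub_conjc R D) conjcM; ring.
  rewrite wxE xE !conjcD !conjcM !conjc_int.
  apply: (lincomb1 (k := m%:~R * n'%:~R - m'%:~R * n%:~R) e); ring.
have w10 : w1 != 0 by apply: contra_neq h => ->; rewrite conjc0 !mulr0 subrr.
split=> //; apply: contra_neq h => /Im_eq0; rewrite conjcM conjc_inv => e.
have w10' : w1^* != 0 by rewrite conjc_eq0.
have -> : w2^* = w2 / w1 * w1^* by rewrite -e divfK.
by field.
Qed.

(** The index and the norm are read off one quantity: [w2 conj w1 - conj w2 w1] is the coordinate
    determinant times [delta], and also [rho delta] up to sign. *)
Lemma ideal_rel_norm I n : is_ideal I -> ideal_norm I n -> rel_norm I n%:R.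
Proof.
move=> iI [p [q [s [t [IE ne]]]]].
have [] := ideal_latt_det iI IE.
set w1 := p%:~R + _; set w2 := s%:~R + _ => w10 hz.
have [_ hI _] := (is_idealP I).1 iI.
have IE' : I = latt w1 w2 by rewrite IE.
rewrite IE' in hI.
have [A [B [Cc [rho [_ hnm _ hdl]]]]] := latt_rel_norm hD w10 hz hI.
suff -> : (n%:R : C) = rho by rewrite IE'.
have dl0 := sqrtD_neq0 R D0; have [_ rho0 _] := hnm.
have e : w2 * w1^* - w2^* * w1 = (p * t - q * s)%:~R * delta.
  rewrite /w1 /w2 -(omega_sub_conjc R D); move: (omega R D) => o.
  rewrite !conjcD !conjcM !conjc_int intrB !intrM; ring.
have hr : rho = (p * t - q * s)%:~R \/ rho = - (p * t - q * s)%:~R.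
  case: hdl; rewrite e => h; [left|right]; apply: (mulIf dl0); first by rewrite h.
  by rewrite mulNr h opprK.
rewrite -ne; case: hr rho0 => ->; rewrite -?mulrNz ltr0z => h.
  by rewrite -[X in _ = X%:~R]gtz0_abs.
by rewrite -abszN -[X in _ = X%:~R]gtz0_abs.
Qed.

Lemma rel_norm_ideal_norm I n : is_ideal I -> rel_norm I n%:R -> ideal_norm I n.
Proof.
move=> iI h; have [k hk] := ideal_basis iI.
have := rel_norm_unique hD h (ideal_rel_norm iI hk) => /eqP; rewrite eqr_nat => /eqP -> //.
Qed.

Lemma ideal_has_rel_norm I : is_ideal I -> exists2 n : nat, (0 < n)%N & rel_norm I n%:R.
Proof.
move=> iI; have [k hk] := ideal_basis iI; have h := ideal_rel_norm iI hk.
by exists k => //; case: h => _; rewrite ltr0n.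
Qed.

Lemma ideal_latt I : is_ideal I -> exists w1 w2 : C,
  [/\ I = latt w1 w2, w1 != 0 & complex.Im (w2 / w1) != 0].
Proof.
move=> iI; have [n [p [q [s [t [IE _]]]]]] := ideal_basis iI.
have [h1 h2] := ideal_latt_det iI IE.
by exists (p%:~R + q%:~R * w), (s%:~R + t%:~R * w); split.
Qed.

(* If [beta] in [conj J] has norm [Nm(J) k] with [k] prime to [N], then
   [(beta / Nm J) J] is integral of norm [k]. *)
Lemma class_rep_coprime J (N : nat) : (1 < N)%N -> is_ideal J ->
  exists (M : set C) (mu : C) (k : nat),
    [/\ is_ideal M, mu != 0, J = scal mu M, coprime k N & rel_norm M k%:R].
Proof.
move=> N1 iJ; have iJc := is_ideal_conjs iJ.
have [w1 [w2 [E w10 hz]]] := ideal_latt iJc.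
have [_ hJc _] := (is_idealP _).1 iJc; rewrite E in hJc.
have [A [B [Cc [rho [hg hnm hform _]]]]] := latt_rel_norm hD w10 hz hJc.
have [m [n hmn]] := primitive_form_coprime (ltnW N1) hg.
have := hform m n; set b := m%:~R * w1 + _.
move: hmn; move: (A * m * m - B * m * n + Cc * n * n) => v hmn hb.
have bJ : conjs J b by rewrite E; exists m, n.
clearbody b.
have [_ rho0 _] := hnm; have rho0' := lt0r_neq0 rho0.
have vn0 : v != 0.
  by apply: contraTneq hmn => ->; rewrite /coprime gcd0n; lia.
have b0 : b != 0.
  apply: contra_neq vn0 => b0; move/eqP: hb.
  by rewrite b0 mul0r eq_sym mulf_eq0 (negPf rho0') intr_eq0 /= => /eqP.
have v0 : 0 <= v by have := mul_conjc_ge0 b; rewrite hb pmulr_rge0// ler0z.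
have hJ : rel_norm J rho by have := rel_norm_conjs hnm; rewrite -E conjsK.
have hM : rel_norm (scal (b / rho) J) (absz v)%:R.
  have -> : ((absz v)%:R : C) = (b / rho) * (b / rho)^* * rho.
    have -> : ((absz v)%:R : C) = v%:~R by rewrite -[in RHS](gez0_abs v0).
    rewrite conjcM conjc_inv (conjc_ge0 (ltW rho0)).
    have -> : b / rho * (b^* / rho) * rho = b * b^* / rho by field.
    by rewrite hb; field.
  by apply: rel_norm_scal => //; rewrite mulf_neq0// invr_eq0.
have s0 : b / rho != 0 by rewrite mulf_neq0// invr_eq0.
exists (scal (b / rho) J), (rho / b), (absz v); split=> //.
- apply/is_idealP; split; first last.
  + have [_ _ [x Jx x0]] := (is_idealP _).1 iJ.
    by exists (b / rho * x); [exists x|rewrite mulf_neq0].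
  + by case: hM.
  move=> _ [x Jx <-].
  have : pid rho (x * b) by case: hJ => _ _ <-; exact: idmul_mem.
  by rewrite pidE => /(scalE _ _ rho0'); rewrite mulrAC mulrC; congr OK; ring.
- by rewrite mulf_neq0// invr_eq0.
- rewrite scalA; have -> : rho / b * (b / rho) = 1 by field; rewrite ?b0 ?rho0'.
  by rewrite scal1.
Qed.

End Ideals.

(** * The discriminant group *)

Section OmegaMap.
Variables (R : realType) (D : int).
Hypothesis hD : neg_fund_disc D.
Local Notation C := R[i].
Local Notation OK := (@Defs.OK R D).
Local Notation OKmod := (@OKmod R D).
Local Notation delta := (sqrtD R D).
Implicit Types (x y : rat * rat) (u v : C).

Let D0 : D < 0. Proof. by case: hD. Qed.

Lemma ofQ_real (q : rat) : ofQ R q = (ratr q : R)%:C.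
Proof. by rewrite /ofQ -(fmorph_rat (real_complex R)). Qed.

Lemma ofQ_int (m : int) : ofQ R m%:~R = m%:~R.
Proof. by rewrite /ofQ ratr_int. Qed.

Lemma ofQ_frac (m : int) (d : nat) : ofQ R (m%:~R / d%:R) = m%:~R / d%:R.
Proof. by rewrite /ofQ rmorphM /= fmorphV /= ratr_int ratr_nat. Qed.

Lemma ofQ0 : ofQ R 0 = 0. Proof. exact: rmorph0. Qed.
Lemma ofQ1 : ofQ R 1 = 1. Proof. exact: rmorph1. Qed.

Lemma Im_rat_comb (p q : rat) (z : C) :
  complex.Im (ofQ R p + ofQ R q * z) = ratr q * complex.Im z.
Proof. by rewrite !ofQ_real; case: z => a b /=; rewrite mul0r addr0 add0r. Qed.

Lemma rat_comb_eq0 (p q : rat) (z : C) : complex.Im z != 0 ->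
  ofQ R p + ofQ R q * z = 0 -> p = 0 /\ q = 0.
Proof.
move=> hz e; have := congr1 (@complex.Im R) e; rewrite Im_rat_comb /= => /eqP.
rewrite mulf_eq0 (negPf hz) orbF fmorph_eq0 => /eqP q0.
move: e; rewrite q0 /ofQ rmorph0 mul0r addr0 => /eqP; rewrite fmorph_eq0 => /eqP ->; by [].
Qed.

Lemma conjc_ofQ (q : rat) : (ofQ R q)^* = ofQ R q.
Proof. by rewrite ofQ_real conjc_real. Qed.

Lemma OKmod_of_End (L : set C) : L 0 -> (forall u v, L u -> L v -> L (u - v)) ->
  latt_End L = OK -> OKmod L.
Proof. by move=> h0 hB hE; split=> // a x; rewrite -hE; exact. Qed.

Lemma latt0 (w1 w2 : C) : latt w1 w2 0.
Proof. by exists 0, 0; rewrite /ofZ !mul0r addr0. Qed.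

Lemma lattB (w1 w2 u v : C) : latt w1 w2 u -> latt w1 w2 v -> latt w1 w2 (u - v).
Proof.
move=> [m [n ->]] [k [l ->]]; exists (m - k), (n - l); rewrite /ofZ !intrB; ring.
Qed.

Variables (f : nat) (z : C) (A B Cc : int).
Hypotheses (f0 : (0 < f)%N) (zH : 0 < complex.Im z) (zE : latt_End (latt 1 z) = OK)
  (hgcd : gcdz (gcdz A B) Cc = 1) (A0 : 0 < A)
  (hroot : A%:~R * z ^+ 2 + B%:~R * z + Cc%:~R = 0).
Local Notation b := (latt 1 z).
Local Notation Om := (Omega f A B Cc z).
Local Notation Om' := (Omega' f A z).

Let hz : complex.Im z != 0. Proof. by rewrite gt_eqF. Qed.
Let A0' : (A%:~R : C) != 0. Proof. by rewrite intr_eq0 gt_eqF. Qed.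
Let f0' : (f%:R : C) != 0. Proof. by rewrite pnatr_eq0 -lt0n. Qed.

Lemma OKmod_b : OKmod b.
Proof. by apply: OKmod_of_End => //; [exact: latt0|exact: lattB]. Qed.

Lemma form_discE : B * B - 4 * A * Cc = D.
Proof. by have [] := form_disc hD hz hgcd hroot OKmod_b. Qed.

(** The sign left open by [form_disc] is decided by [A > 0] and [z] in the upper half plane. *)
Lemma sqrtD_form : delta = 2 * A%:~R * z + B%:~R.
Proof.
have [_ []//] := form_disc hD hz hgcd hroot OKmod_b.
move=> /(congr1 (@complex.Im R)) h; exfalso.
have h1 := Im_sqrtD_gt0 R D0; rewrite h in h1.
move: h1; have -> : 2 * A%:~R * z + B%:~R = B%:~R + (2 * A)%:~R * z :> C.
  by rewrite intrM addrC.
rewrite -[- _]mulN1r -[-1]/((-1)%:~R) mulrDr mulrA -!intrM Im_int_comb pmulr_lgt0//.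
rewrite ltr0z; lia.
Qed.

Lemma disc_orderE : disc_order f A B Cc = (f * f * absz D)%N.
Proof.
rewrite /disc_order -form_discE !abszM; congr (_ * _)%N.
by rewrite -abszN; congr absz; ring.
Qed.

Lemma i_sqrt_disc_order :
  (0 +i* 1) * ofR (Num.sqrt (disc_order f A B Cc)%:R) = f%:R * delta.
Proof.
rewrite disc_orderE /ofR /sqrtD natrM sqrtrM ?ler0n// natrM -expr2 sqrtr_sqr ger0_norm//.
have -> : ((absz D)%:R : R) = - D%:~R.
  by rewrite -mulrNz -[in RHS]ltz0_abs.
have -> : (f%:R : C) = (f%:R : R)%:C by rewrite -(rmorph_nat (real_complex R)).
by apply/eqP; rewrite eq_complex /= !mul0r !mulr0 !mul1r !subr0 !addr0 ?add0r !eqxx.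
Qed.

Lemma sqrt2Af_neq0 : ofR (Num.sqrt (2%:R * A%:~R * f%:R : R)) != 0.
Proof.
apply/eqP => /(congr1 (@complex.Re R)) /= /eqP; apply/negP.
by rewrite sqrtr_eq0 -ltNge !mulr_gt0// ?ltr0z// ltr0n.
Qed.

(* The factor [i sqrt |G|] is [f sqrt D], the generator of [c]. *)
Lemma OmegaE y : Om y = f%:R * delta * (ofQ R y.1 - ofQ R y.2 * z).
Proof.
by rewrite /Omega /Omega' -mulrA mulKf ?sqrt2Af_neq0// i_sqrt_disc_order.
Qed.

Lemma ofQ_gram x y : ofQ R (gram f A B Cc x y) =
  f%:R * (2 * A%:~R * ofQ R x.1 * ofQ R y.1 + B%:~R * (ofQ R x.1 * ofQ R y.2 + ofQ R x.2 * ofQ R y.1)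
          + 2 * Cc%:~R * ofQ R x.2 * ofQ R y.2).
Proof.
by rewrite /ofQ /gram !(rmorphD, rmorphM) /= !ratr_nat !ratr_int !rmorph1.
Qed.

(** The coordinates of [Omega y] on [(1, z)] are the pairings of [y] with [e1] and [e2]; hence the
    dual lattice is exactly the preimage of [b]. *)
Lemma Omega_gram y : Om y =
  ofQ R (gram f A B Cc y (0, 1)) + ofQ R (gram f A B Cc y (1, 0)) * z.
Proof.
rewrite OmegaE !ofQ_gram /= /ofQ !rmorph0 !rmorph1 sqrtD_form.
move: hroot => hr.
by apply: (lincomb1 (k := - 2 * f%:R * ratr y.2) hr); ring.
Qed.

Lemma OmegaB x y : Om (x.1 - y.1, x.2 - y.2) = Om x - Om y.
Proof. rewrite !OmegaE /= /ofQ !rmorphB /=; ring. Qed.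

Lemma Omega_inj : injective Om.
Proof.
move=> x y e; have := OmegaB x y; rewrite e subrr OmegaE /= => /eqP.
rewrite !mulf_eq0 (negPf f0') (negPf (sqrtD_neq0 R D0)) /= => /eqP h.
have : ofQ R (x.1 - y.1) + ofQ R (- (x.2 - y.2)) * z = 0.
  by rewrite -[RHS]h /ofQ rmorphN mulNr.
case/(rat_comb_eq0 hz) => /subr0_eq e1 /eqP; rewrite oppr_eq0 => /eqP /subr0_eq e2.
by case: x y e1 e2 {e h} => [? ?] [? ?] /= -> ->.
Qed.

Lemma in_dualP y : in_dual f A B Cc y <-> b (Om y).
Proof.
rewrite Omega_gram; split.
  move=> [[k ->] [l ->]]; exists l, k; by rewrite /ofZ !ofQ_int mulr1.
move=> [m [n]]; rewrite /ofZ mulr1 => e.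
have : ofQ R (gram f A B Cc y (0, 1) - m%:~R) + ofQ R (gram f A B Cc y (1, 0) - n%:~R) * z = 0.
  rewrite /ofQ !rmorphB /= !ratr_int.
  by apply: (lincomb1 (k := 1) e); rewrite /ofQ; ring.
by case/(rat_comb_eq0 hz) => /subr0_eq e1 /subr0_eq e2; split; [exists n|exists m].
Qed.

Lemma Omega_latP u :
  (exists l, in_lat l /\ u = Om l) <-> scal (f%:R * delta) b u.
Proof.
split.
  move=> [_ [[m [n ->]] ->]]; rewrite OmegaE /= !ofQ_int.
  by exists (m%:~R - n%:~R * z) => //; exists m, (- n); rewrite /ofZ mulr1 mulrNz mulNr.
move=> [_ [m [n ->]] <-]; exists (m%:~R, (- n)%:~R); split; first by exists m, (- n).
by rewrite OmegaE /= !ofQ_int /ofZ mulr1 mulrNz mulNr opprK.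
Qed.

Lemma scal_cbar : scal (f%:R * delta) b = idmul (cbar D f) b.
Proof. by rewrite idmulC /cbar idmul_pid//; exact: OKmod_b. Qed.

Definition frac (p : int * int) : rat * rat :=
  let d := (disc_order f A B Cc)%:R : rat in (p.1%:~R / d, p.2%:~R / d).

Lemma disc_order_neq0 : (disc_order f A B Cc)%:R != 0 :> rat.
Proof. by rewrite disc_orderE pnatr_eq0 !muln_eq0 absz_eq0; move: D0 f0; lia. Qed.

Lemma frac_inj : injective frac.
Proof.
move=> [a1 b1] [a2 b2] [] e1 e2.
have h := disc_order_neq0.
have hi : ((disc_order f A B Cc)%:R)^-1 != 0 :> rat by rewrite invr_eq0.
by move: e1 e2 => /(mulIf hi)/intr_inj -> /(mulIf hi)/intr_inj ->.
Qed.

Lemma Omega_surj u : b u -> exists p, Om (frac p) = u.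
Proof.
move=> [k2 [k1 ->]]; rewrite /ofZ mulr1.
(* Cramer's rule: the adjugate of the Gram matrix applied to [(k1, k2)]; [frac] divides by the
   determinant. *)
exists (f%:Z * (2 * Cc * k1 - B * k2), f%:Z * (2 * A * k2 - B * k1)).
have hd := disc_order_neq0.
have hd' : (disc_order f A B Cc)%:R != 0 :> C by move: hd; rewrite !pnatr_eq0.
rewrite Omega_gram !ofQ_gram /frac /= !ofQ_frac !ofQ0 !ofQ1 !(intrM, intrB).
have e : (disc_order f A B Cc)%:R = f%:R * f%:R * (4 * A%:~R * Cc%:~R - B%:~R * B%:~R) :> C.
  rewrite disc_orderE !natrM; congr (_ * _).
  have -> : ((absz D)%:R : C) = - D%:~R by rewrite -mulrNz -[in RHS]ltz0_abs.
  rewrite -form_discE intrB !intrM; ring.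
rewrite e in hd' *; field.
by move: hd'; rewrite !mulf_eq0 !negb_or => /andP[/andP[-> _] ->].
Qed.

Lemma Omega_frac_congr (p p' : int * int) :
  (exists l, in_lat l /\ Om (frac p) = Om (frac p') + Om l) <->
  exists m n : int, p.1 = p'.1 + m * (f * f * absz D)%N /\ p.2 = p'.2 + n * (f * f * absz D)%N.
Proof.
have hd := disc_order_neq0.
have dE : ((disc_order f A B Cc)%:R : rat) = ((f * f * absz D)%N : int)%:~R.
  by rewrite disc_orderE.
rewrite dE in hd; split.
  move=> [l [[m [n ->]] e]].
  have : Om ((frac p).1 - (frac p').1, (frac p).2 - (frac p').2) = Om (m%:~R, n%:~R).
    by rewrite OmegaB e addrAC subrr add0r.
  move=> /Omega_inj [] /=; rewrite dE -!mulrBl => e1 e2.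
  exists m, n; split; apply: (@intr_inj rat); rewrite intrD intrM.
    by rewrite -e1 divfK// addrC subrK.
  by rewrite -e2 divfK// addrC subrK.
move=> [m [n [e1 e2]]]; exists (m%:~R, n%:~R); split; first by exists m, n.
have -> : Om (m%:~R, n%:~R) = Om (frac p) - Om (frac p').
  rewrite -OmegaB; congr Om; rewrite /frac /= dE e1 e2 -!mulrBl -!intrB.
  have sub (x y : int) : x + y - x = y by rewrite addrAC subrr add0r.
  by rewrite !sub !intrM !mulfK.
by rewrite addrC subrK.
Qed.

Definition kappa : C := ofR (Num.sqrt (2%:R * A%:~R * f%:R)) / (f%:R * delta).

Lemma kappa_neq0 : kappa != 0.
Proof. by rewrite !mulf_neq0 ?sqrt2Af_neq0// invr_eq0 mulf_neq0// sqrtD_neq0. Qed.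

Lemma Omega'E y : Om' y = kappa * Om y.
Proof.
rewrite OmegaE /Omega' /kappa; field.
by rewrite f0' sqrtD_neq0.
Qed.

(** Rewrites the exponent of [f_act]: the factor [|D| = - delta^2] is absorbed by the [f delta] in
    [Omega]. *)
Lemma gram_norm y : f%:R * (absz D)%:R * ofQ R (gram f A B Cc y y) =
  2 * A%:~R * (Om y * (Om y)^*).
Proof.
have hr := hroot.
have [ht hn] := form_trace hD hz hgcd hroot OKmod_b A0.
rewrite OmegaE ofQ_gram.
have -> : ((absz D)%:R : C) = - (delta * delta).
  by rewrite (sqrtD_sqr R D0) -mulrNz -[in RHS]ltz0_abs.
move: (conjc_ofQ y.1) (conjc_ofQ y.2) (conjc_sqrtD R D).
move: (ofQ R y.1) (ofQ R y.2) (sqrtD R D) => p q e hp hq he.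
rewrite !conjcM conjcB conjcM hp hq he conjc_nat.
have -> : 2 * A%:~R * (f%:R * e * (p - q * z) * (f%:R * - e * (p - q * z^*))) =
  2 * A%:~R * (f%:R * f%:R * - (e * e) * (p * p - p * q * (z + z^*) + q * q * (z * z^*))) by ring.
by rewrite ht hn; field.
Qed.

End OmegaMap.

(** * The finite character on a lattice *)

Section Coprime.
Variables (R : realType) (D : int).
Hypothesis hD : neg_fund_disc D.
Local Notation C := R[i].
Local Notation OK := (@Defs.OK R D).
Local Notation pid := (@Defs.pid R D).
Local Notation OKmod := (@OKmod R D).
Local Notation rel_norm := (@rel_norm R D).
Local Notation is_ideal := (@is_ideal R D).
Implicit Types (a b c x y : C) (I J K L M : set C).

Lemma coprime_id_sub I I' J J' : I `<=` I' -> J `<=` J' ->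
  coprime_id I J -> coprime_id I' J'.
Proof. by move=> sI sJ [x [y [/sI Ix [/sJ Jy e]]]]; exists x, y. Qed.

Lemma idmul_sub_mod I L : is_ideal I -> OKmod L -> idmul I L `<=` L.
Proof.
move=> /is_idealP [sI _ _] hL; rewrite -[X in _ `<=` X](idmul_OK hL) idmulC.
exact: idmul_subset.
Qed.

Lemma coprime_idmul I J K : is_ideal I -> is_ideal J -> is_ideal K ->
  coprime_id I K -> coprime_id J K -> coprime_id (idmul I J) K.
Proof.
move=> /is_idealP [sI hI _] /is_idealP [sJ hJ _] /is_idealP [sK hK _].
move=> [x [y [Ix [Ky e]]]] [x' [y' [Jx' [Ky' e']]]].
exists (x * x'), (y + x * y'); split; first exact: idmul_mem.
split; last by rewrite -[RHS]e -[x in RHS]mulr1 -e'; ring.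
by apply: (OKmodD hK) => //; case: hK => _ _; apply=> //; exact: sI.
Qed.

Lemma coprime_idmull I J K : is_ideal I -> is_ideal J ->
  coprime_id (idmul I J) K -> coprime_id I K.
Proof.
move=> /is_idealP [sI hI _] /is_idealP [sJ hJ _]; apply: coprime_id_sub => //.
by rewrite -[X in _ `<=` X](idmul_OK hI); exact: idmul_subset.
Qed.

Lemma coprime_pid_congr K a b : is_ideal K -> K (a - b) ->
  coprime_id (pid b) K -> coprime_id (pid a) K.
Proof.
move=> /is_idealP [_ hK _] Kab [_ [y [[t ot <-] [Ky e]]]].
exists (a * t), (y - t * (a - b)); split; first by exists t.
split; last by rewrite -e; ring.
by case: hK => _ KB KM; apply: KB => //; exact: KM.
Qed.

Lemma coprime_pidMr K a b : OK a -> coprime_id (pid (a * b)) K -> coprime_id (pid b) K.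
Proof.
move=> oa; apply: coprime_id_sub => // _ [t ot <-]; exists (a * t); first exact: OKM.
by ring.
Qed.

Lemma prime_to_ideal cf I : is_ideal cf -> is_ideal I -> coprime_id I cf -> prime_to D cf I.
Proof.
move=> icf iI hI; split.
  by exists 1; split=> //; rewrite -[X in _ X]/(scal 1 I) scal1.
exists I, OK; split=> //; split; first exact: is_ideal_OK.
split=> //; split; last by have [_ hm _] := (is_idealP _ _).1 iI; exact: idmul_OK.
have [_ hm _] := (is_idealP _ _).1 icf.
exists 1, 0; split; [exact: OK1|split; [by case: hm|by rewrite addr0]].
Qed.

End Coprime.

Section Psi.
Variables (R : realType) (D : int).
Hypothesis hD : neg_fund_disc D.
Local Notation C := R[i].
Local Notation OK := (@Defs.OK R D).
Local Notation pid := (@Defs.pid R D).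
Local Notation OKmod := (@OKmod R D).
Local Notation rel_norm := (@rel_norm R D).
Local Notation is_ideal := (@is_ideal R D).
Variables (b q cf M c : set C) (mu : C) (chi' : C -> C).

Definition psi (w : C) : C :=
  if `[< M (w / mu) /\ coprime_id (pid (w / mu)) cf >] then chi' (w / mu) else 0.

Hypotheses (hb : OKmod b) (iq : is_ideal q) (icf : is_ideal cf) (iM : is_ideal M)
  (mu0 : mu != 0) (hqb : idmul q b = scal mu M) (hc : c `<=` idmul q cf)
  (hchi : residue_char D cf chi') (hccf : c `<=` cf).

Lemma cb_sub_cfM : idmul c b `<=` scal mu (idmul cf M).
Proof.
rewrite -idmul_scalr -hqb idmulA (idmulC cf); exact: idmul_subset.
Qed.

(** Both memberships matter for periodicity: [M] governs the support of [psi], [cf] the coprimality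
    condition and the value of [chi']. *)
Lemma cfM_sub x : idmul cf M x -> cf x /\ M x.
Proof.
have [sM hM _] := (is_idealP _ _).1 iM; have [scf hcf _] := (is_idealP _ _).1 icf.
move=> h; split.
  by rewrite -(idmul_OK hcf); move: x h; exact: idmul_subset.
by rewrite -(idmul_OK hM) idmulC; move: x h; exact: idmul_subset.
Qed.

Lemma psi_periodic w w' : idmul c b (w - w') -> psi w = psi w'.
Proof.
have [sM hM _] := (is_idealP _ _).1 iM; have [scf hcf _] := (is_idealP _ _).1 icf.
have [hc1 [_ _]] := hchi.
have half u v : cf (u - v) -> M (u - v) -> M v /\ coprime_id (pid v) cf ->
    M u /\ coprime_id (pid u) cf.
  move=> h1 h2 [Mv cv]; split; last exact: (coprime_pid_congr icf h1).
  by rewrite -(subrK v u); exact: (OKmodD hM).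
move=> /cb_sub_cfM /(scalE _ _ mu0) /cfM_sub []; rewrite mulrBl => h1 h2.
have h1' : cf (w' / mu - w / mu) by rewrite -opprB; exact: (OKmodN hcf).
have h2' : M (w' / mu - w / mu) by rewrite -opprB; exact: (OKmodN hM).
rewrite /psi; case: asboolP => hw; case: asboolP => hw' //.
- by case: hw hw' => ? ? [? ?]; apply: hc1 => //; exact: sM.
- by case: hw'; exact: half hw.
- by case: hw; exact: half hw'.
Qed.

(** The delicate point is that the support is also stable under division by [g], although [g] is
    invertible only modulo [c]. *)
Lemma psi_equivariant g w : OK g -> coprime_id (pid g) c -> b w ->
  psi (g * w) = chi' g * psi w.
Proof.
have [sM hM _] := (is_idealP _ _).1 iM; have [scf hcf _] := (is_idealP _ _).1 icf.
have [_ [hcM _]] := hchi.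
move=> og cg bw.
have cg' : coprime_id (pid g) cf by exact: coprime_id_sub cg.
rewrite /psi -mulrA; set a := w / mu.
case: asboolP => h1; case: asboolP => h2.
- case: h1 h2 => ? ? [? ?]; apply: hcM => //; exact: sM.
- case: h2; case: h1 => h1 h3; split; last exact: coprime_pidMr h3.
  (* With [1 = g t + y] and [y] in [c], [a = t (g a) + y a], where [y w] lies in [c b] and so [y a]
     in [M]. *)
  case: cg => _ [y [[t ot <-] [cy e]]].
  have -> : a = t * (g * a) + y * a by rewrite -[LHS]mul1r -e; ring.
  apply: (OKmodD hM); first by case: hM => _ _; exact.
  have : idmul c b (y * w) by exact: idmul_mem.
  by move=> /cb_sub_cfM /(scalE _ _ mu0) /cfM_sub []; rewrite mulrA.
- case: h1; case: h2 => h2 h3; split; first by case: hM => _ _; exact.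
  have [x [y [[t ot e1] [cfy e]]]] := h3.
  have [x' [y' [[t' ot' e1'] [cfy' e']]]] := cg'.
  exists (g * a * (t * t')), (y' + g * t' * y); split.
    by exists (t * t') => //; exact: OKM.
  split; first by apply: (OKmodD hcf) => //; case: hcf => _ _; apply=> //; exact: OKM.
  rewrite -e1 in e; rewrite -e1' in e'.
  by apply: (lincomb2 (k := g * t') (k' := 1) e e'); ring.
- by rewrite mulr0.
Qed.

End Psi.

(** * Integral ideals in a given class *)

Section Fibre.
Variables (R : realType) (D : int).
Hypothesis hD : neg_fund_disc D.
Local Notation C := R[i].
Local Notation OK := (@Defs.OK R D).
Local Notation pid := (@Defs.pid R D).
Local Notation OKmod := (@OKmod R D).
Local Notation rel_norm := (@rel_norm R D).
Local Notation is_ideal := (@is_ideal R D).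
Implicit Types (I M : set C) (a m : C).

(* [a M^-1], as [M^-1 = conj M / m] when [m] is the norm of [M]. *)
Definition quot_ideal M m a : set C := scal (a / m) (conjs M).

Lemma quot_idealP M m a I : rel_norm M m -> OKmod I -> idmul I M = pid a <-> I = quot_ideal M m a.
Proof.
move=> hM hI; have [hM1 m0 hM2] := hM; have m0' := lt0r_neq0 m0.
split.
  move=> e; apply: (scal_inj m0').
  have := idmul_conjsl hM hI; rewrite (idmulC M) e (idmul_pid _ (OKmod_conjs hM1)) => <-.
  by rewrite /quot_ideal scalA; congr scal; field.
move=> ->; rewrite /quot_ideal idmul_scal idmulC hM2 pid_scal; congr pid; by field.
Qed.

Lemma quot_ideal_is_ideal M m a : rel_norm M m -> is_ideal M -> M a -> a != 0 ->
  is_ideal (quot_ideal M m a).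
Proof.
move=> hM iM Ma a0; have [hM1 m0 hM2] := hM; have m0' := lt0r_neq0 m0.
have [sM _ [x Mx x0]] := (is_idealP _ _).1 iM.
apply/is_idealP; split.
- move=> _ [y My <-].
  have : pid m (a * y) by rewrite -hM2; exact: idmul_mem.
  by rewrite pidE => /(scalE _ _ m0'); rewrite mulrAC.
- exact/OKmod_scal/OKmod_conjs.
- exists (a / m * x^*); first by exists x^* => //; exists x.
  by rewrite !mulf_neq0 ?invr_eq0// conjc_eq0.
Qed.

Lemma rel_norm_quot_ideal M m a : rel_norm M m -> a != 0 -> rel_norm (quot_ideal M m a) (a * a^* / m).
Proof.
move=> hM a0; have [hM1 m0 hM2] := hM; have m0' := lt0r_neq0 m0.
have -> : a * a^* / m = (a / m) * (a / m)^* * m.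
  by rewrite conjcM conjc_inv (conjc_ge0 (ltW m0)); field.
by apply: rel_norm_scal; [rewrite mulf_neq0 ?invr_eq0|exact: rel_norm_conjs].
Qed.

End Fibre.

(** * Absolutely convergent double series *)

Section BoxSums.
Variable R : realType.
Local Notation C := R[i].
Implicit Types (F : int * int -> C) (G : int * int -> R).

Definition box (N : nat) : seq (int * int) :=
  [seq (i%:Z - N%:Z, j%:Z - N%:Z) | i <- iota 0 N.*2.+1, j <- iota 0 N.*2.+1].

Arguments box : simpl never.

Lemma mem_box N p : (p \in box N) = (absz p.1 <= N)%N && (absz p.2 <= N)%N.
Proof.
apply/allpairsP/idP => [[[i j] [+ + ->]]|].
  by rewrite !mem_iota /= => hi hj; lia.
case: p => m n /andP[hm hn].
exists (absz (m + N%:Z)%R, absz (n + N%:Z)%R); rewrite !mem_iota /=.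
by move: hm hn => /= hm hn; split; [lia|lia|congr pair; lia].
Qed.

Lemma box_uniq N : uniq (box N).
Proof.
apply: allpairs_uniq; [exact: iota_uniq|exact: iota_uniq|].
by move=> [i j] [k l] _ _ /= [e1 e2]; congr pair; lia.
Qed.

Lemma sum_box (V : zmodType) (F : int * int -> V) N : \sum_(p <- box N) F p =
  \sum_(i < N.*2.+1) \sum_(j < N.*2.+1) F (i%:Z - N%:Z, j%:Z - N%:Z).
Proof.
rewrite big_allpairs_dep -(big_mkord xpredT (fun i => \sum_(j < N.*2.+1) F (i%:Z - N%:Z, j%:Z - N%:Z))).
rewrite /index_iota subn0; apply: eq_bigr => i _.
by rewrite -(big_mkord xpredT (fun j => F (i%:Z - N%:Z, j%:Z - N%:Z))) /index_iota subn0.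
Qed.

Lemma sub_box (s : seq (int * int)) : exists N, {subset s <= box N}.
Proof.
elim: s => [|p s [N ih]]; first by exists 0%N.
exists (maxn N (maxn (absz p.1) (absz p.2))) => r; rewrite inE => /orP[/eqP ->|/ih]; rewrite !mem_box.
  by rewrite !leq_max !leqnn !orbT.
by move=> /andP[h1 h2]; rewrite !leq_max h1 h2.
Qed.

Lemma ler_sum_uniq_sub (T : eqType) (s t : seq T) (g : T -> R) : uniq s -> uniq t ->
  {subset s <= t} -> (forall p, 0 <= g p) -> \sum_(p <- s) g p <= \sum_(p <- t) g p.
Proof.
move=> us ut st g0; rewrite [leRHS](bigID (mem s)) /=.
have -> : \sum_(i <- t | i \in s) g i = \sum_(p <- s) g p.
  rewrite -big_filter; apply: perm_big; apply: uniq_perm => //; first exact: filter_uniq.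
  by move=> p; rewrite mem_filter; case ps : (p \in s) => //=; rewrite st.
by rewrite lerDl sumr_ge0.
Qed.

(** Unconditional summation: every finite set containing a large box is allowed, so the value does
    not depend on the exhaustion chosen. *)
Definition has_sum F (l : C) : Prop := forall e : R, 0 < e -> exists N : nat,
  forall s, uniq s -> {subset box N <= s} -> `|\sum_(p <- s) F p - l| < e%:C.

Lemma has_sum_ext F F' l : F =1 F' -> has_sum F l -> has_sum F' l.
Proof. by move=> /funext ->. Qed.

Lemma has_sumD F F' l l' : has_sum F l -> has_sum F' l' ->
  has_sum (fun p => F p + F' p) (l + l').
Proof.
move=> h h' e e0; have e20 : 0 < e / 2 by rewrite divr_gt0.
have [N hN] := h _ e20; have [N' hN'] := h' _ e20.
exists (maxn N N') => s us sN.
have h1 := hN s us; have h2 := hN' s us.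
have -> : e%:C = (e / 2)%:C + (e / 2)%:C by rewrite -rmorphD /= -splitr.
rewrite big_split /= opprD addrACA (le_lt_trans (ler_normD _ _))// ltrD//.
  by apply: h1 => p; rewrite !mem_box => hp; apply: sN; rewrite mem_box; lia.
by apply: h2 => p; rewrite !mem_box => hp; apply: sN; rewrite mem_box; lia.
Qed.

Lemma normc_realE (x : C) : exists2 r : R, 0 <= r & `|x| = r%:C.
Proof.
exists (Num.sqrt (complex.Re x ^+ 2 + complex.Im x ^+ 2)); first exact: sqrtr_ge0.
exact: normc_def.
Qed.

Lemma has_sumZ c F l : has_sum F l -> has_sum (fun p => c * F p) (c * l).
Proof.
move=> h e e0; have [r r0 hr] := normc_realE c.
have e20 : 0 < e / (r + 1) by rewrite divr_gt0// ltr_pwDr.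
have [N hN] := h _ e20; exists N => s us sN.
rewrite -mulr_sumr -mulrBr normrM hr.
have := hN s us sN; set X := `| _ | => hX.
have [x x0 hx] := normc_realE (\sum_(p <- s) F p - l); rewrite -/X in hx.
rewrite hx -rmorphM /= ltcR; rewrite hx ltcR in hX.
have : x * (r + 1) < e by rewrite -ltr_pdivlMr// ltr_pwDr.
by apply: le_lt_trans; rewrite mulrC ler_wpM2l// lerDl.
Qed.

Lemma has_sum0 : has_sum (fun=> 0) 0.
Proof. by move=> e e0; exists 0%N => s _ _; rewrite big1// subrr normr0 ltcR. Qed.

Lemma has_sum_sum (T : Type) (r : seq T) (F : T -> int * int -> C) (l : T -> C) :
  (forall t, has_sum (F t) (l t)) ->
  has_sum (fun p => \sum_(t <- r) F t p) (\sum_(t <- r) l t).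
Proof.
move=> h; elim: r => [|t r ih].
  by rewrite big_nil; apply: has_sum_ext has_sum0 => p; rewrite big_nil.
rewrite big_cons; apply: has_sum_ext (has_sumD (h t) ih) => p.
by rewrite big_cons.
Qed.

(** Applied to the boxes of [Z2sum] and to the norm sublevels that cut off [theta]. *)
Lemma has_sum_cvg F l (E : nat -> seq (int * int)) : has_sum F l ->
  (forall n, uniq (E n)) ->
  (forall N, exists n0, forall n, (n0 <= n)%N -> {subset box N <= E n}) ->
  (fun n => \sum_(p <- E n) F p : Cnf R) @ \oo --> (l : Cnf R).
Proof.
move=> h uE hE; apply/cvgrPdist_lt => e e0.
have er : e = (complex.Re e)%:C :> C by rewrite RRe_real// gtr0_real.
have re0 : 0 < complex.Re e by move: e0; rewrite er ltcR.
have [N hN] := h _ re0; have [n0 hn0] := hE N.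
exists n0 => // n /= hn; rewrite distrC er; apply: hN => //; exact: hn0.
Qed.

Lemma cvg_Cnf_lim (u : nat -> Cnf R) (l : Cnf R) : u @ \oo --> l -> limn u = l.
Proof. by move=> h; apply: cvg_lim => //; exact: norm_hausdorff. Qed.

Lemma cvg_sum_seq (T : Type) (s : seq T) (u : T -> nat -> Cnf R) (l : T -> Cnf R) :
  (forall t, u t @ \oo --> l t) ->
  (fun n => \sum_(t <- s) u t n) @ \oo --> \sum_(t <- s) l t.
Proof.
move=> h; apply/cvgrPdist_lt; elim: s => [|t s ih] e e0.
  by near=> n; rewrite !big_nil subrr normr0.
have e20 : 0 < e / 2 by rewrite divr_gt0.
have h1 := (cvgrPdist_lt _ _).1 (h t) _ e20; have h2 := ih _ e20.
near=> n; rewrite !big_cons opprD addrACA [e]splitr.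
apply: le_lt_trans (ler_normD _ _) _; apply: ltrD; near: n; [exact: h1|exact: h2].
Unshelve. all: by end_near.
Qed.

Lemma Z2sum_has_sum F l : has_sum F l -> Z2sum (fun m n => F (m, n)) = l.
Proof.
move=> h; rewrite /Z2sum; apply: cvg_Cnf_lim.
rewrite (_ : (fun N : nat => _) = (fun N => \sum_(p <- box N) F p : Cnf R)); last first.
  by apply/funext => N; rewrite sum_box.
apply: has_sum_cvg h _ _; first exact: box_uniq.
move=> N; exists N => n hn p; rewrite !mem_box; lia.
Qed.

Lemma has_sum_nonneg G (K : R) : (forall p, 0 <= G p) ->
  (forall N, \sum_(p <- box N) G p <= K) ->
  exists l, has_sum (fun p => (G p)%:C) l.
Proof.
move=> G0 GK; pose S := [set \sum_(p <- box N) G p | N in [set: nat]].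
have hS : has_sup S.
  split; first by exists (\sum_(p <- box 0) G p), 0%N.
  by exists K => _ [N _ <-].
exists (sup S)%:C => e e0.
have [_ [N _ <-] hN] := sup_adherent e0 hS.
exists N => s us sN.
rewrite -rmorph_sum -rmorphB normc_def /= expr0n addr0 sqrtr_sqr ltcR.
rewrite ltr_distl; apply/andP; split.
  by rewrite (lt_le_trans hN)// ler_sum_uniq_sub// box_uniq.
have [M hM] := sub_box s.
apply: (@le_lt_trans _ _ (sup S)); last by rewrite ltrDl.
apply: (@le_trans _ _ (\sum_(p <- box M) G p)); first by rewrite ler_sum_uniq_sub// box_uniq.
by apply: sup_upper_bound => //; exists M.
Qed.

Lemma has_sum_dominated F G (K : R) : (forall p, `|F p| <= (G p)%:C) ->
  (forall N, \sum_(p <- box N) G p <= K) -> exists l, has_sum F l.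
Proof.
move=> FG GK.
have G0 p : 0 <= G p by rewrite -ler0c (le_trans (normr_ge0 _) (FG p)).
(* A signed [H] is the difference of the nonnegative functions [H + G] and [G]. *)
have real (H : int * int -> R) : (forall p, `|H p| <= G p) ->
    exists l, has_sum (fun p => (H p)%:C) l.
  move=> HG.
  have [l hl] := has_sum_nonneg G0 GK.
  have [l' hl'] : exists l, has_sum (fun p => (H p + G p)%:C) l.
    apply: (@has_sum_nonneg _ (K + K)).
      by move=> p; have := HG p; rewrite ler_norml => /andP[h _]; rewrite -lerBlDr sub0r.
    move=> N; rewrite big_split /= lerD//.
    apply: le_trans (GK N); apply: ler_sum => p _; exact: le_trans (ler_norm _) (HG p).
  exists (l' + (-1) * l); apply: has_sum_ext (has_sumD hl' (has_sumZ (-1) hl)) => p.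
  by rewrite rmorphD /= mulN1r addrK.
have [a ha] : exists l, has_sum (fun p => (complex.Re (F p))%:C) l.
  apply: real => p; rewrite -lecR; apply: le_trans (FG p); exact: normc_ge_Re.
have [b hb] : exists l, has_sum (fun p => (complex.Im (F p))%:C) l.
  apply: real => p; rewrite -lecR; apply: le_trans (FG p).
  have -> : complex.Im (F p) = - complex.Re (F p * 'i%C) by rewrite ReiNIm opprK.
  rewrite normrN (le_trans (normc_ge_Re _))// normrM.
  by rewrite [X in _ * X](_ : _ = 1) ?mulr1// normc_def /= expr0n expr1n add0r sqrtr1.
exists (a + 'i%C * b); apply: has_sum_ext (has_sumD ha (has_sumZ 'i%C hb)) => p.
by rewrite -complexE.
Qed.

(** Telescoping: [1 / (1 + n^2)] is at most [4 / (n + 1) - 4 / (n + 2)], because [3 n^2 - 3 n + 2]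
    is positive. *)
Lemma sum_inv1Dsqr (n : nat) :
  \sum_(0 <= i < n) (1 + i%:R ^+ 2)^-1 <= 5 - 4 / (n.+1)%:R :> R.
Proof.
elim: n => [|n ih]; first by rewrite big_nil divr1; lra.
rewrite big_nat_recr//=; apply: le_trans (lerD ih (lexx _)) _.
rewrite -[n.+2]addn1 -[n.+1]addn1 !natrD.
have : (0 : R) <= n%:R by [].
move: (n%:R) => x x0.
have h1 : 0 < x + 1 by lra.
have h2 : 0 < x + 1 + 1 by lra.
have h3 : 0 < 1 + x ^+ 2 by nra.
rewrite -subr_ge0.
have -> : 5 - 4 / (x + 1 + 1) - (5 - 4 / (x + 1) + (1 + x ^+ 2)^-1) =
  (3 * x ^+ 2 - 3 * x + 2) / ((x + 1) * (x + 1 + 1) * (1 + x ^+ 2)).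
  by field; rewrite !gt_eqF.
by rewrite divr_ge0 ?mulr_ge0 ?ltW//; nra.
Qed.

Lemma sum_inv1Dsqr_box (N : nat) :
  \sum_(i < N.*2.+1) (1 + ((i%:Z - N%:Z)%:~R : R) ^+ 2)^-1 <= 10.
Proof.
have b5 n : \sum_(0 <= i < n) (1 + i%:R ^+ 2)^-1 <= 5 :> R.
  by apply: le_trans (sum_inv1Dsqr n) _; rewrite gerBl divr_ge0.
rewrite -(big_mkord xpredT (fun i : nat => (1 + ((i%:Z - N%:Z)%:~R : R) ^+ 2)^-1)).
rewrite (@big_cat_nat _ _ _ N)//=; last by lia.
have -> : 10 = 5 + 5 :> R by lra.
apply: lerD; last first.
  rewrite -{1}[N]add0n big_addn; have -> : (N.*2.+1 - N = N.+1)%N by lia.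
  apply: le_trans (b5 N.+1); rewrite le_eqVlt; apply/orP; left; apply/eqP.
  apply: eq_bigr => i _; by rewrite PoszD addrK.
rewrite big_nat_rev /= add0n.
have -> : \sum_(0 <= i < N) (1 + (((N - i.+1)%:Z - N%:Z)%:~R : R) ^+ 2)^-1 =
          \sum_(0 <= i < N) (1 + (i.+1%:R : R) ^+ 2)^-1.
  apply: eq_big_nat => i /andP[_ hi].
  have -> : (N - i.+1)%:Z - N%:Z = - i.+1%:Z by lia.
  by rewrite mulrNz sqrrN.
have := b5 N.+1; rewrite big_nat_recl//=; apply: le_trans; rewrite lerDr invr_ge0.
by rewrite expr0n /= addr0.
Qed.

(** The exponential absorbs [(1 + g)^3]: one factor bounds the square root, two bound
    [(1 + m^2) (1 + n^2)]. The constant [L] comes from [1 + g <= L (1 + k g / 3) <= L exp(k g / 3)].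
    The product form of the bound lets the double sum factor. *)
Lemma gauss_bound (k c : R) : 0 < k -> 0 < c -> exists2 K : R, 0 <= K &
  forall g m n : R, 0 <= g -> m ^+ 2 + n ^+ 2 <= c * g ->
    Num.sqrt g * expR (- (k * g)) <= K * ((1 + m ^+ 2)^-1 * (1 + n ^+ 2)^-1).
Proof.
move=> k0 c0; pose L := 1 + 3 / k; pose c' := 1 + c.
have L0 : 0 < L by rewrite /L ltr_pwDl// divr_ge0// ltW.
have c'1 : 1 <= c' by rewrite /c' lerDl ltW.
exists (c' ^+ 2 * L ^+ 3); first by rewrite mulr_ge0// exprn_ge0// ltW//; lra.
move=> g m n g0 hmn.
have h1 : 0 < 1 + m ^+ 2 by nra.
have h2 : 0 < 1 + n ^+ 2 by nra.
rewrite -invfM ler_pdivlMr; last exact: mulr_gt0.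
have s1 : Num.sqrt g <= 1 + g.
  have := sqr_sqrtr g0; have := sqrtr_ge0 g; move: (Num.sqrt g) => s s0 <-; nra.
have s2 : (1 + m ^+ 2) * (1 + n ^+ 2) <= c' ^+ 2 * (1 + g) ^+ 2.
  rewrite -exprMn; apply: (@le_trans _ _ ((1 + m ^+ 2 + n ^+ 2) ^+ 2)); first by nra.
  rewrite lerXn2r// ?nnegrE; [nra|nra|].
  by rewrite -addrA /c'; nra.
have s3 : (1 + g) ^+ 3 <= L ^+ 3 * expR (k * g).
  have -> : k * g = (k * g / 3) * 3%:R by rewrite divfK.
  rewrite expRM_natr -exprMn lerXn2r ?nnegrE//; [lra|by rewrite mulr_ge0 ?expR_ge0 ?ltW|].
  apply: (@le_trans _ _ (L * (1 + k * g / 3))); last by rewrite ler_pM2l// expR_ge1Dx.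
  have -> : L * (1 + k * g / 3) = 1 + g + (3 / k + k * g / 3).
    by rewrite /L; field; rewrite gt_eqF.
  by rewrite lerDl addr_ge0// ?divr_ge0// ?mulr_ge0// ltW.
have e0 := expR_gt0 (- (k * g)).
apply: (@le_trans _ _ ((1 + g) * expR (- (k * g)) * (c' ^+ 2 * (1 + g) ^+ 2))).
  apply: ler_pM; [|by rewrite mulr_ge0// ltW| |exact: s2].
    by rewrite mulr_ge0 ?sqrtr_ge0// ltW.
  by rewrite ler_wpM2r// ltW.
have -> : (1 + g) * expR (- (k * g)) * (c' ^+ 2 * (1 + g) ^+ 2) =
   c' ^+ 2 * ((1 + g) ^+ 3 * expR (- (k * g))) by ring.
rewrite ler_wpM2l ?sqr_ge0//.
apply: (@le_trans _ _ (L ^+ 3 * expR (k * g) * expR (- (k * g)))).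
  by rewrite ler_wpM2r// ltW.
by rewrite -mulrA -expRD subrr expR0 mulr1.
Qed.

Lemma has_sum_gauss F (k c K0 : R) (g : int * int -> R) : 0 < k -> 0 < c -> 0 <= K0 ->
  (forall p, 0 <= g p) ->
  (forall p, (p.1%:~R) ^+ 2 + (p.2%:~R) ^+ 2 <= c * g p) ->
  (forall p, `|F p| <= (K0 * (Num.sqrt (g p) * expR (- (k * g p))))%:C) ->
  exists l, has_sum F l.
Proof.
move=> k0 c0 K00 g0 hg hF; have [K Kp hK] := gauss_bound k0 c0.
pose G (p : int * int) := K0 * K * ((1 + (p.1%:~R : R) ^+ 2)^-1 * (1 + (p.2%:~R : R) ^+ 2)^-1).
apply: (@has_sum_dominated _ G (K0 * K * (10 * 10))).
  move=> p; apply: le_trans (hF p) _; rewrite lecR /G -mulrA ler_wpM2l//.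
  exact: hK.
move=> N; rewrite /G -mulr_sumr ler_wpM2l ?mulr_ge0//.
rewrite (sum_box (fun p => (1 + (p.1%:~R : R) ^+ 2)^-1 * (1 + (p.2%:~R : R) ^+ 2)^-1)) /=.
rewrite -big_distrlr /=; apply: ler_pM; rewrite ?sum_inv1Dsqr_box//;
  by apply: sumr_ge0 => i _; rewrite invr_ge0 addr_ge0// sqr_ge0.
Qed.

Lemma normc_cexp (u : C) : `|cexp u| = (expR (complex.Re u))%:C.
Proof.
rewrite normc_def /cexp /=; congr (_ %:C).
rewrite !exprMn -mulrDr cos2Dsin2 mulr1 sqrtr_sqr ger0_norm//; exact: expR_ge0.
Qed.

Lemma sqr_le_quadratic (z : C) : complex.Im z != 0 -> exists2 c : R, 0 < c &
  forall m n : R, (m ^+ 2 + n ^+ 2)%:C <= c%:C * ((m%:C - n%:C * z) * (m%:C - n%:C * z)^*).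
Proof.
case: z => x y /= y0.
have y2 : 0 < y ^+ 2 by rewrite lt_def sqr_ge0 andbT expf_neq0.
(* Writing [m = (m - n x) + n x] gives [m^2 + n^2 <= 2 (m - n x)^2 + (2 x^2 + 1) n^2], and
   [n^2 = (n y)^2 / y^2]. *)
exists (2 + (2 * x ^+ 2 + 1) / y ^+ 2).
  by rewrite addr_gt0// divr_gt0//; nra.
move=> m n.
have -> : (m%:C - n%:C * (x +i* y)) * (m%:C - n%:C * (x +i* y))^* =
  ((m - n * x) ^+ 2 + n ^+ 2 * y ^+ 2)%:C.
  by apply/eqP; rewrite eq_complex /=; apply/andP; split; apply/eqP; ring.
rewrite -rmorphM lecR.
have -> : (2 + (2 * x ^+ 2 + 1) / y ^+ 2) * ((m - n * x) ^+ 2 + n ^+ 2 * y ^+ 2) =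
  2 * (m - n * x) ^+ 2 + 2 * n ^+ 2 * y ^+ 2 + (2 * x ^+ 2 + 1) * n ^+ 2 +
  (2 * x ^+ 2 + 1) * (m - n * x) ^+ 2 / y ^+ 2.
  by field.
have : 0 <= (2 * x ^+ 2 + 1) * (m - n * x) ^+ 2 / y ^+ 2.
  apply: divr_ge0; last exact: ltW.
  by apply: mulr_ge0; [nra|exact: sqr_ge0].
have h1 : 0 <= (m - 2 * n * x) ^+ 2 by exact: sqr_ge0.
have h2 : 0 <= (n * y) ^+ 2 by exact: sqr_ge0.
move: (_ / _) => t t0; nra.
Qed.

End BoxSums.

(** * Theta series and the span *)

(** The level [f |D|] therefore exceeds 1: coprimality to it excludes 0, and 1 is among the residues
    listed in [F_gen]. *)
Lemma fund_disc_abs_gt1 (D : int) : neg_fund_disc D -> (1 < absz D)%N.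
Proof. by move=> [D0 [[h _]|[m [e _]]]]; lia. Qed.

Section Assembly.
Variables (R : realType) (D : int).
Hypothesis hD : neg_fund_disc D.
Local Notation C := R[i].
Local Notation OK := (@Defs.OK R D).
Local Notation pid := (@Defs.pid R D).
Local Notation OKmod := (@OKmod R D).
Local Notation rel_norm := (@rel_norm R D).
Local Notation is_ideal := (@is_ideal R D).
Local Notation delta := (sqrtD R D).
Variables (f : nat) (f0 : (0 < f)%N).
Variables (h : nat) (z : 'I_h -> C).
Hypotheses (hzH : forall a, 0 < complex.Im (z a))
  (hzCM : forall a, latt_End (latt 1 (z a)) = OK)
  (hzdist : forall a b, a != b -> ~ homothetic (latt 1 (z a)) (latt 1 (z b)))
  (hzall : forall w1 w2 : C, w1 != 0 -> complex.Im (w2 / w1) != 0 ->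
             latt_End (latt w1 w2) = OK ->
             exists a, homothetic (latt w1 w2) (latt 1 (z a))).
Variables (A B Cc : 'I_h -> int).
Hypothesis hABC : forall a, [/\ gcdz (gcdz (A a) (B a)) (Cc a) = 1, 0 < A a &
            ofZ R (A a) * z a ^+ 2 + ofZ R (B a) * z a + ofZ R (Cc a) = 0].
Variables (phi : set C -> C) (cf : set C) (chi' : C -> C).
Hypotheses (hphi : hecke_char D cf phi chi') (hcf : cbar D f `<=` cf).
Variables (r : nat) (r0 : (0 < r)%N) (q : set C).
Hypotheses (iq : is_ideal q) (nq : rel_norm q r%:R) (hqc : cbar D f `<=` idmul q cf).

Local Notation b := (fun a => latt 1 (z a)).
Local Notation c := (@cbar R D f).

Let D0 : D < 0. Proof. by case: hD. Qed.
Let icf : is_ideal cf. Proof. by case: hphi. Qed.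
Let hchi' : residue_char D cf chi'. Proof. by case: hphi => _ []. Qed.
Let hb a : OKmod (b a). Proof. exact: (OKmod_b (hzCM a)). Qed.
Let hgcd a : gcdz (gcdz (A a) (B a)) (Cc a) = 1. Proof. by case: (hABC a). Qed.
Let hA a : 0 < A a. Proof. by case: (hABC a). Qed.
Let hroot a : (A a)%:~R * z a ^+ 2 + (B a)%:~R * z a + (Cc a)%:~R = 0.
Proof. by case: (hABC a). Qed.
Let hA' a : ((A a)%:~R : C) != 0. Proof. by rewrite intr_eq0 gt_eqF. Qed.
Let nb a : rel_norm (b a) ((A a)%:~R)^-1.
Proof.
have hz : complex.Im (z a) != 0 by rewrite gt_eqF.
exact: (rel_norm_form hD hz (hgcd a) (hroot a) (hb a) (hA a)).
Qed.

Lemma level_mem_cbar : c (f * absz D)%:R.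
Proof.
exists (- delta); first exact/OKN/OK_sqrtD.
rewrite mulrN -mulrA (sqrtD_sqr R D0) natrM -mulrN; congr (_ * _).
by rewrite -mulrNz -[in LHS]ltz0_abs.
Qed.

(** The triple is [(M, mu, Nm M)], packed for a single use of choice. [class_rep_coprime] wants an
    integral ideal, so it is applied to [q (A b)]; the norm of [M] is prime to [f |D|], which lies
    in [c] and hence in [cf]. *)
Lemma rep_exists a : exists t : set C * C * C,
  [/\ is_ideal t.1.1, coprime_id t.1.1 cf, t.1.2 != 0, idmul q (b a) = scal t.1.2 t.1.1 &
   rel_norm t.1.1 t.2 /\ r%:R = (A a)%:~R * (t.1.2 * t.1.2^*) * t.2].
Proof.
have b1 : b a 1 by exists 1, 0; rewrite /ofZ mul0r addr0 mul1r.
have iAb : is_ideal (scal (A a)%:~R (b a)).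
  apply/is_idealP; split.
  - move=> _ [x bx <-].
    have : pid ((A a)%:~R)^-1 (x * 1).
      have [_ _ <-] := nb a; apply: idmul_mem => //.
      by exists 1 => //; rewrite conjc1.
    rewrite pidE => /scalE; rewrite invr_eq0 invrK mulr1 mulrC => h1; exact: h1.
  - exact: OKmod_scal.
  - by exists ((A a)%:~R * 1); [exists 1|rewrite mulr1].
have iJ := is_ideal_idmul hD iq iAb.
have N1 : (1 < f * absz D)%N.
  by have := fund_disc_abs_gt1 hD; move: f0 => f0' hh; rewrite (leq_trans hh)// leq_pmull.
have [M [mu [k [iM mu0 JE cop nM]]]] := class_rep_coprime hD N1 iJ.
have e : idmul q (b a) = scal (mu / (A a)%:~R) M.
  apply: (scal_inj (hA' a)); rewrite -idmul_scalr JE scalA; congr scal.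
  by rewrite mulrCA divff// mulr1.
have mu0' : mu / (A a)%:~R != 0 by rewrite mulf_neq0// invr_eq0.
exists (M, mu / (A a)%:~R, k%:R); split=> //=.
- have [sM hM _] := (is_idealP _ _).1 iM.
  have Mk : M k%:R.
    have [_ _ hMM] := nM.
    have : pid k%:R k%:R by exact: pid_mem.
    by rewrite -hMM idmulC; exact: (idmul_sub_mod (is_ideal_conjs iM) hM).
  have [u [v huv]] : exists u v : int, u * k%:Z + v * (f * absz D)%:Z = 1.
    have [u [v huv]] := Bezoutz k%:Z (f * absz D)%:Z; exists u, v; rewrite huv.
    by rewrite /gcdz /=; move/eqP: cop => ->.
  exists (u%:~R * k%:R), (v%:~R * (f * absz D)%:R); split; first exact: (OKmodMz u hM Mk).
  have [_ hcf' _] := (is_idealP _ _).1 icf.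
  split; first by apply: (OKmodMz v hcf'); apply: hcf; exact: level_mem_cbar.
  by rewrite -[RHS]/(1%:~R) -huv intrD !intrM.
- split=> //.
  have n1 := rel_norm_idmul hD nq (nb a).
  rewrite e in n1; have n2 := rel_norm_scal mu0' nM.
  have := rel_norm_unique hD n1 n2 => h1.
  by rewrite -mulrA -h1 mulrCA divff// mulr1.
Qed.

Variables (M : 'I_h -> set C) (mu m : 'I_h -> C).
Hypotheses (iM : forall a, is_ideal (M a)) (hMcf : forall a, coprime_id (M a) cf)
  (mu0 : forall a, mu a != 0) (hqb : forall a, idmul q (b a) = scal (mu a) (M a))
  (nM : forall a, rel_norm (M a) (m a))
  (hrm : forall a, r%:R = (A a)%:~R * (mu a * (mu a)^*) * m a).

Let m0 a : 0 < m a. Proof. by case: (nM a). Qed.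
Let m0' a : m a != 0. Proof. exact: lt0r_neq0. Qed.

Local Notation Om a p := (Omega f (A a) (B a) (Cc a) (z a) (frac f (A a) (B a) (Cc a) p)).
Local Notation ps a := (psi D cf (M a) (mu a) chi').
Local Notation id_ a x := (quot_ideal (M a) (m a) x).

(** Indexing by numerators puts the ideals and the generators on the same set of pairs of integers;
    values outside [M a] are killed by [psi]. *)
Definition alpha (a : 'I_h) (p : int * int) : C := Om a p / mu a.

Lemma mu_M_sub_b a x : M a x -> b a (mu a * x).
Proof.
move=> Mx; apply: (idmul_sub_mod iq (hb a)).
by rewrite hqb; exists x.
Qed.

Lemma alpha_inj a : injective (alpha a).
Proof.
move=> p p' /(mulIf _) e; have {}e : Om a p = Om a p' by apply: e; rewrite invr_eq0.
apply: (frac_inj hD f0 (hzH a) (hzCM a) (hgcd a) (hA a) (hroot a)).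
exact: (Omega_inj hD f0 (hzH a) (hzCM a) (hgcd a) (hA a) (hroot a) e).
Qed.

Lemma alpha_surj a x : M a x -> exists p, alpha a p = x.
Proof.
move=> /mu_M_sub_b bx.
have [p hp] := Omega_surj hD f0 (hzH a) (hzCM a) (hgcd a) (hA a) (hroot a) bx.
by exists p; rewrite /alpha hp mulrC mulKf.
Qed.

(* The lattice [conj (I q)] is homothetic to some [b a], so [I q (b a)] is principal. *)
Lemma class_exists I : is_ideal I -> exists a x, [/\ M a x, x != 0 & I = id_ a x].
Proof.
move=> iI; have iJ := is_ideal_idmul hD iI iq.
have [nJ nJ0 hJ] := ideal_has_rel_norm hD iJ.
have [w1 [w2 [E w10 hw]]] := ideal_latt hD (is_ideal_conjs iJ).
have hE : latt_End (latt w1 w2) = OK by rewrite -E; exact: (rel_norm_End hD (rel_norm_conjs hJ)).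
have [a [l [l0 hl]]] := hzall w10 hw hE.
have [_ hI _] := (is_idealP _ _).1 iI.
rewrite -[X in _ = X]/(scal l _) -E in hl.
have [_ _ hJJ] := hJ.
have nJ1 : (nJ%:R : C) != 0 by rewrite pnatr_eq0 -lt0n.
have e : idmul I (M a) = pid (l * nJ%:R / mu a).
  apply: (scal_inj (mu0 a)); rewrite -idmul_scalr -hqb idmulA hl idmul_scalr hJJ !pid_scal.
  by congr pid; rewrite mulrCA divff// mulr1.
exists a, (l * nJ%:R / mu a); split.
- have : idmul I (M a) (l * nJ%:R / mu a) by rewrite e; exact: pid_mem.
  have [_ hMa _] := (is_idealP _ _).1 (iM a).
  exact: (idmul_sub_mod iI hMa).
- by rewrite !mulf_neq0// invr_eq0.
- exact/(quot_idealP _ (nM a) hI).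
Qed.

(** Equal quotients make [M a] and [M a'] proportional; multiplying [q b = mu M] by [conj q] removes
    [q] at the cost of a factor [r], so the two lattices would be homothetic. *)
Lemma class_unique a a' x x' : M a x -> x != 0 -> x' != 0 -> id_ a x = id_ a' x' -> a = a'.
Proof.
move=> Mx x0 x'0 e; apply/eqP; apply: contraT => /hzdist; case.
have s1 : x / m a != 0 by rewrite mulf_neq0// invr_eq0.
have s2 : x' / m a' != 0 by rewrite mulf_neq0// invr_eq0.
have e2 : M a' = scal ((x / m a) / (x' / m a'))^* (M a).
  have : conjs (id_ a x) = conjs (id_ a' x') by rewrite e.
  rewrite /quot_ideal !conjs_scal !conjsK => /(congr1 (scal ((x' / m a')^*)^-1)).
  have s2' : (x' / m a')^* != 0 by rewrite conjc_eq0.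
  rewrite !scalA mulVf// scal1 => <-; congr scal.
  by rewrite [RHS]conjcM conjc_inv mulrC.
have s3 : ((x / m a) / (x' / m a'))^* != 0 by rewrite conjc_eq0 mulf_neq0// invr_eq0.
move: e2 s3; move: (_^*) => t e2 t0.
exists (mu a' * t / mu a); split; first by rewrite !mulf_neq0// invr_eq0.
have r0' : (r%:R : C) != 0 by rewrite pnatr_eq0 -lt0n.
have h1 a1 := idmul_conjsl nq (hb a1).
apply: (scal_inj r0'); rewrite -[[set _ | _ in _]]/(scal _ (b a)).
have -> : scal r%:R (scal (mu a' * t / mu a) (b a)) = scal (mu a' * t / mu a) (scal r%:R (b a)).
  by rewrite !scalA mulrC.
rewrite -!h1 !hqb e2 !idmul_scalr !scalA.
by congr scal; rewrite divfK.
Qed.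

Definition phi0 (I : set C) : C := if `[< coprime_id I cf >] then phi I else 0.

Lemma phi_M_neq0 a : phi (M a) != 0.
Proof. by case: hphi => _ [_ [_ [h1 _]]]; apply: h1; exact: (prime_to_ideal hD). Qed.

(** As [M a] is prime to [cf], the ideal is prime to [cf] exactly when [x] is, so the extensions by
    zero of [phi] and [chi'] match. *)
Lemma phi0_quot_ideal a x : M a x -> x != 0 ->
  phi0 (id_ a x) = (phi (M a))^-1 * x * ps a (mu a * x).
Proof.
move=> Mx x0; have iI := quot_ideal_is_ideal (nM a) (iM a) Mx x0.
have [_ hI _] := (is_idealP _ _).1 iI.
have e := (quot_idealP x (nM a) hI).2 erefl.
have [sM _ _] := (is_idealP _ _).1 (iM a).
have ex : mu a * x / mu a = x by rewrite mulrC mulKf.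
rewrite /phi0 /psi ex.
case: asboolP => h1; case: asboolP => h2.
- case: h2 => _ h2; case: hphi => _ [_ [hmul [hne [hpr _]]]].
  have := hmul _ _ (prime_to_ideal hD icf iI h1) (prime_to_ideal hD icf (iM a) (hMcf a)).
  rewrite e hpr//; last exact: sM.
  move=> h3; rewrite -mulrA h3 mulrCA mulVf ?mulr1//; exact: phi_M_neq0.
- by case: h2; split=> //; rewrite -e; exact: (coprime_idmul iI (iM a) icf).
- by case: h1; case: h2 => _; rewrite -e; exact: (coprime_idmull iI (iM a)).
- by rewrite mulr0.
Qed.

Definition norm_fibre (n : nat) : set ('I_h * (int * int)) :=
  [set x | [/\ M x.1 (alpha x.1 x.2), alpha x.1 x.2 != 0 &
     alpha x.1 x.2 * (alpha x.1 x.2)^* = n%:R * m x.1]].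

Definition ideal_of (x : 'I_h * (int * int)) : set C := id_ x.1 (alpha x.1 x.2).

Lemma ideal_of_image n : [set I | is_ideal I /\ ideal_norm D I n] = ideal_of @` norm_fibre n.
Proof.
apply/seteqP; split => I.
  move=> [iI nI]; have [a [x [Mx x0 IE]]] := class_exists iI.
  have [p hp] := alpha_surj Mx.
  exists (a, p); last by rewrite /ideal_of /= hp.
  split; rewrite /= hp//.
  have h1 := ideal_rel_norm hD iI nI; rewrite IE in h1.
  have := rel_norm_unique hD h1 (rel_norm_quot_ideal (nM a) x0) => ->.
  by rewrite divfK.
move=> [[a p] [/= Mx x0 e] <-].
have iI := quot_ideal_is_ideal (nM a) (iM a) Mx x0; split=> //.
apply: (rel_norm_ideal_norm hD iI).
have := rel_norm_quot_ideal (nM a) x0; rewrite e mulfK//.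
Qed.

Definition unitsOK : set C := [set u | pid u = OK].

Lemma unitsOK_neq0 u : unitsOK u -> u != 0.
Proof.
move=> e; apply/eqP => u0; have := OK1 R D; rewrite -e u0 => -[y _].
by rewrite mul0r => /esym/eqP; rewrite oner_eq0.
Qed.

(* The fibre of [ideal_of] over [I] is a torsor under the units. *)
Lemma fibre_bij n I : is_ideal I -> ideal_norm D I n ->
  exists2 x0 : C, x0 != 0 &
  set_bij (norm_fibre n `&` [set x | ideal_of x = I]) unitsOK (fun x => alpha x.1 x.2 / x0).
Proof.
move=> iI nI; have [a [x0 [Mx x00 IE]]] := class_exists iI.
have hI1 := (is_idealP _ _).1 iI; have [_ hI _] := hI1.
have e0 : idmul I (M a) = pid x0 by apply/(quot_idealP _ (nM a) hI).
have fst_eq x : (norm_fibre n `&` [set x | ideal_of x = I]) x -> x.1 = a.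
  move=> [[h1 h2 h3] h4]; apply: (class_unique h1 h2 x00).
  by rewrite -IE.
exists x0 => //; split.
- move=> x hx; have ea := fst_eq _ hx; case: x hx ea => a' p [[/= h1 h2 h3] /= h4] ea.
  rewrite ea in h1 h2 h3 h4 *.
  have e1 : idmul I (M a) = pid (alpha a p).
    by apply/(quot_idealP _ (nM a) hI); rewrite -h4 /ideal_of.
  rewrite /unitsOK /= mulrC -pid_scal -e1 e0 !pidE scalA mulVf// scal1.
  by [].
- move=> x y; rewrite !inE => hx hy; have ex := fst_eq _ hx; have ey := fst_eq _ hy.
  move=> /(mulIf _) e; have {}e : alpha x.1 x.2 = alpha y.1 y.2 by apply: e; rewrite invr_eq0.
  case: x y ex ey e {hx hy} => [a1 p1] [a2 p2] /= -> -> e.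
  by rewrite (alpha_inj e).
- move=> u hu; have u0 := unitsOK_neq0 hu.
  have ou : OK u by rewrite -[X in X _]hu; exact: pid_mem.
  have Mu : M a (u * x0) by have [_ [_ _ hM] _] := (is_idealP _ _).1 (iM a); exact: hM.
  have [p hp] := alpha_surj Mu.
  have pe : pid (u * x0) = pid x0 by rewrite mulrC -pid_scal hu.
  exists (a, p); last by rewrite /= hp mulfK.
  have ie : id_ a (u * x0) = I by apply/esym/(quot_idealP _ (nM a) hI); rewrite e0 pe.
  split; last by rewrite /= /ideal_of /= hp.
  split; rewrite /= hp// ?mulf_neq0//.
  have h1 := ideal_rel_norm hD iI nI; rewrite -ie in h1.
  have ux0 : u * x0 != 0 by rewrite mulf_neq0.
  have := rel_norm_unique hD h1 (rel_norm_quot_ideal (nM a) ux0) => ->.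
  by rewrite divfK.
Qed.

(** [alpha a p] is a constant times [p.1 - p.2 z]. The bound yields both the finiteness of the norm
    levels and the Gaussian decay. *)
Lemma alpha_quad a : exists2 k : R, 0 < k & forall p : int * int,
  ((p.1%:~R) ^+ 2 + (p.2%:~R) ^+ 2)%:C <= k%:C * (alpha a p * (alpha a p)^*).
Proof.
have hz : complex.Im (z a) != 0 by rewrite gt_eqF.
have [k k0 hk] := sqr_le_quadratic hz.
have dE := disc_orderE hD f (hzH a) (hzCM a) (hgcd a) (hroot a).
set d := disc_order f (A a) (B a) (Cc a) in dE.
have d0 : (d%:R : C) != 0.
  by rewrite pnatr_eq0 dE !muln_eq0 absz_eq0; move: D0 f0; lia.
pose s : C := f%:R * delta / d%:R / mu a.
have s0 : s != 0 by rewrite !mulf_neq0 ?invr_eq0 ?sqrtD_neq0// pnatr_eq0 -lt0n.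
have ss0 := mul_conjc_gt0 s0.
have [t t0 tE] : exists2 t : R, 0 < t & s * s^* = t%:C.
  exists (complex.Re (s * s^*)); last by rewrite RRe_real// gtr0_real.
  by rewrite -ltcR RRe_real// gtr0_real.
exists (k / t); first exact: divr_gt0.
move=> p.
have -> : alpha a p = s * ((p.1%:~R)%:C - (p.2%:~R)%:C * z a).
  rewrite /alpha (OmegaE hD f0 (hzH a) (hzCM a) (hgcd a) (hA a) (hroot a)) /frac /=.
  rewrite -/d !ofQ_frac -!intr_complex /s; field.
  by rewrite d0 mu0.
apply: le_trans (hk _ _) _; rewrite le_eqVlt; apply/orP; left; apply/eqP.
move: (_ - _) => v; rewrite conjcM.
have -> : s * v * (s^* * v^*) = s * s^* * (v * v^*) by ring.
rewrite tE [RHS]mulrA -(rmorphM (real_complex R)) /= divfK//.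
by rewrite gt_eqF.
Qed.

Lemma level_box a (n : nat) : exists N, forall p,
  alpha a p * (alpha a p)^* <= n%:R * m a -> p \in box N.
Proof.
have [k k0 hk] := alpha_quad a.
have mR : m a = (complex.Re (m a))%:C by rewrite RRe_real// gtr0_real.
have [N hN] : exists N : nat, k * (n%:R * complex.Re (m a)) < N%:R.
  by eexists; exact: truncnS_gt.
exists N => p hp.
have : ((p.1%:~R) ^+ 2 + (p.2%:~R) ^+ 2 : R) < N%:R.
  apply: le_lt_trans hN; rewrite -lecR; apply: le_trans (hk p) _.
  have -> : (k * (n%:R * complex.Re (m a)))%:C = k%:C * (n%:R * m a).
    by rewrite [in RHS]mR !(rmorphM (real_complex R)) /= (rmorph_nat (real_complex R)).
  by rewrite ler_pM2l// ltcR.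
have sq (i : int) : (i%:~R : R) ^+ 2 = ((absz i) ^ 2)%:R.
  by rewrite natrX -real_normK ?num_real// natr_absz intr_norm.
rewrite !sq -natrD ltr_nat mem_box => hlt.
have h1 : (absz p.1 <= absz p.1 ^ 2)%N by rewrite -mulnn; case: (absz p.1) => // k'; exact: leq_pmulr.
have h2 : (absz p.2 <= absz p.2 ^ 2)%N by rewrite -mulnn; case: (absz p.2) => // k'; exact: leq_pmulr.
apply/andP; split; [apply: (leq_trans h1)|apply: (leq_trans h2)];
  by apply: (leq_trans _ (ltnW hlt)); rewrite ?leq_addr ?leq_addl.
Qed.

Lemma norm_fibre_finite n : finite_set (norm_fibre n).
Proof.
have /choice [N hN] : forall a, exists N, forall p,
  alpha a p * (alpha a p)^* <= n%:R * m a -> p \in box N by move=> a; exact: level_box.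
apply: (@sub_finite_set _ _ [set` [seq (a, p) | a <- enum 'I_h, p <- box (N a)]]).
  move=> [a p] [/= _ _ e].
  suff hs : (a, p) \in [seq (a, p) | a <- enum 'I_h, p <- box (N a)] by exact: hs.
  apply/allpairsPdep; exists a, p; split=> //; first by rewrite mem_enum.
  by apply: hN; rewrite e.
exact: finite_seq.
Qed.

(** The units are the image of the fibre over [O_K], which lies in one finite norm level. *)
Lemma unitsOK_finite : finite_set unitsOK.
Proof.
have iO := is_ideal_OK R hD; have [n hn] := ideal_basis hD iO.
have [x0 _ [_ _ hs]] := fibre_bij iO hn.
apply: (sub_finite_set hs); apply: finite_image.
by apply: (sub_finite_set _ (norm_fibre_finite n)) => x [].
Qed.

Definition num_units : C := \sum_(u \in unitsOK) (1 : C).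

Lemma num_units_neq0 : num_units != 0.
Proof.
rewrite /num_units fsbig_finite; last exact: unitsOK_finite.
rewrite big_const_seq count_predT iter_addr_0 pnatr_eq0 -lt0n.
have : 1 \in fset_set unitsOK.
  rewrite in_fset_set; last exact: unitsOK_finite.
  by rewrite inE /unitsOK /= pidE scal1.
by move=> h1; rewrite -has_predT; apply/hasP; exists 1.
Qed.

Lemma theta_coef_norm_fibre n :
  num_units * theta_coef D cf phi n = \sum_(x \in norm_fibre n) phi0 (ideal_of x).
Proof.
rewrite /theta_coef -/phi0 ideal_of_image.
set S := ideal_of @` norm_fibre n.
have finX := norm_fibre_finite n; have finS : finite_set S by exact: finite_image.
rewrite !fsbig_finite// mulr_sumr.
transitivity (\sum_(x <- fset_set (norm_fibre n)) \sum_(I <- fset_set S | I == ideal_of x) phi0 I); last first.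
  rewrite big_seq [RHS]big_seq; apply: eq_bigr => x.
  rewrite in_fset_set// inE => hx; rewrite -big_filter.
  rewrite (_ : [seq _ <- _ | _] = [:: ideal_of x]) ?big_seq1//.
  rewrite filter_pred1_uniq ?fset_uniq// in_fset_set// inE; by exists x.
rewrite (exchange_big_dep xpredT)//= big_seq [RHS]big_seq; apply: eq_bigr => I.
rewrite in_fset_set// inE -[S]/(ideal_of @` norm_fibre n) -ideal_of_image => -[iI nI].
have [x0 _ hbij] := fibre_bij iI nI.
rewrite /num_units (reindex_fsbig _ _ _ (fun=> 1) hbij) fsbig_finite; last first.
  by apply: (sub_finite_set _ finX) => x [].
rewrite mulr_suml.
transitivity (\sum_(x <- fset_set (norm_fibre n `&` [set x | ideal_of x = I])) phi0 I).
  by apply: eq_bigr => x _; rewrite mul1r.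
rewrite [RHS](eq_bigl (fun x => x \in [set x | ideal_of x = I])); last first.
  by move=> x /=; apply/eqP/idP; rewrite inE.
rewrite -[RHS]big_filter; apply: perm_big; apply: uniq_perm.
- exact: fset_uniq.
- by rewrite filter_uniq// fset_uniq.
- move=> x; rewrite mem_filter !in_fset_set//; last by apply: (sub_finite_set _ finX) => y [].
  by rewrite in_setI andbC.
Qed.

(** * Generators as double series and comparison with theta *)

Variable chi : C -> C.
Hypotheses (hchi : residue_char D c chi)
  (hpull : forall a, OK a -> coprime_id (pid a) c -> chi' a = (chi a)^-1).

Local Notation kap a := (kappa R D f (A a)).
Local Notation fr a p := (frac f (A a) (B a) (Cc a) p).

Definition q_exp a (tau : C) p : C :=
  cexp (2%:R * ofR pi * 'i * tau * ((A a)%:~R * (Om a p * (Om a p)^*))).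

Definition psi_term a tau p : C := ps a (Om a p) * (kap a * Om a p) * q_exp a tau p.

(** Kept convertible to the summand of [f_act], so that [Z2sum_has_sum] applies directly. *)
Definition f_term a (g : C) (y0 : rat * rat) (tau : C) (p : int * int) : C :=
  if `[< in_dual f (A a) (B a) (Cc a) (fr a p) /\
         exists l, in_lat l /\ g * Om a p = Omega f (A a) (B a) (Cc a) (z a) y0
                                       + Omega f (A a) (B a) (Cc a) (z a) l >]
  then Omega' f (A a) (z a) (fr a p) *
       cexp (ofR pi * 'i * f%:R * ofZ R (absz D) * tau
             * ofQ R (gram f (A a) (B a) (Cc a) (fr a p) (fr a p)))
  else 0.

Lemma q_exp_gram a tau p :
  cexp (ofR pi * 'i * f%:R * ofZ R (absz D) * tau
             * ofQ R (gram f (A a) (B a) (Cc a) (fr a p) (fr a p))) = q_exp a tau p.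
Proof.
rewrite /q_exp; congr cexp.
have e := gram_norm hD f0 (hzH a) (hzCM a) (hgcd a) (hA a) (hroot a) (fr a p).
have -> : ofZ R (absz D) = (absz D)%:R by [].
move: (gram _ _ _ _ _ _) (ofR pi) (Om a p * _) e => gr P w e.
by apply: (lincomb1 (k := P * 'i * tau) e); ring.
Qed.

Definition sqnorm_Omega a p : R := complex.Re (Om a p) ^+ 2 + complex.Im (Om a p) ^+ 2.

Lemma sqnorm_OmegaE a p : (sqnorm_Omega a p)%:C = Om a p * (Om a p)^*.
Proof. by rewrite /sqnorm_Omega add_Re2_Im2 sqr_normc. Qed.

Lemma sqnorm_Omega_quad a : exists2 k : R, 0 < k & forall p : int * int,
  (p.1%:~R) ^+ 2 + (p.2%:~R) ^+ 2 <= k * sqnorm_Omega a p.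
Proof.
have [k k0 hk] := alpha_quad a.
have mm := mul_conjc_gt0 (mu0 a).
have tE : mu a * (mu a)^* = (complex.Re (mu a * (mu a)^*))%:C by rewrite RRe_real// gtr0_real.
move: tE mm; move: (complex.Re _) => t tE; rewrite tE ltcR => t0.
exists (k / t); first exact: divr_gt0.
move=> p; rewrite -lecR; apply: le_trans (hk p) _.
rewrite le_eqVlt; apply/orP; left; apply/eqP.
have -> : alpha a p * (alpha a p)^* = (sqnorm_Omega a p)%:C / t%:C.
  rewrite /alpha sqnorm_OmegaE -tE; move: (Omega _ _ _ _ _ _) => w; rewrite conjcM conjc_inv; field.
  by rewrite conjc_eq0 mu0.
rewrite !(rmorphM (real_complex R)) /= fmorphV /=.
by rewrite mulrCA mulrA [RHS]mulrAC; congr (_ * _); rewrite mulrC.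
Qed.

Lemma f_term_summable a g y0 tau : 0 < complex.Im tau ->
  exists l, has_sum (f_term a g y0 tau) l.
Proof.
move=> t0; have [k k0 hk] := sqnorm_Omega_quad a.
have [K0 K00 hK] := normc_realE (kap a).
(* The decay rate: [q_exp] has absolute value [exp(- kk |w|^2)]. *)
pose kk := 2 * pi * (A a)%:~R * complex.Im tau : R.
have kk0 : 0 < kk by rewrite !mulr_gt0// ?pi_gt0// ltr0z.
apply: (has_sum_gauss kk0 k0 K00 _ hk).
  by move=> p; rewrite addr_ge0// sqr_ge0.
move=> p; rewrite /f_term; case: asboolP => _; last first.
  by rewrite normr0 ler0c !mulr_ge0 ?sqrtr_ge0// expR_ge0.
rewrite q_exp_gram (Omega'E hD f0 (hzH a) (hzCM a) (hgcd a) (hA a) (hroot a)).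
rewrite normrM [X in X * _]normrM hK (normc_def (Omega _ _ _ _ _ _)) -/(sqnorm_Omega a p) normc_cexp.
rewrite le_eqVlt; apply/orP; left; apply/eqP.
rewrite !(rmorphM (real_complex R)) /= -mulrA; congr (_ * (_ * _)); congr ((expR _)%:C).
rewrite -sqnorm_OmegaE.
have -> : 2%:R * ofR pi * 'i * tau * ((A a)%:~R * (sqnorm_Omega a p)%:C) =
  (2 * pi * (A a)%:~R * sqnorm_Omega a p)%:C * ('i%C * tau).
  rewrite intr_complex !(rmorphM (real_complex R)) /= (rmorph_nat (real_complex R)).
  rewrite /ofR -/(pi%:C) -complexiE; ring.
rewrite /kk {kk kk0}; case: tau t0 => x y /= _; ring.
Qed.

Lemma has_sum_f_act a g y0 tau : 0 < complex.Im tau ->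
  has_sum (f_term a g y0 tau) (f_act D f (A a) (B a) (Cc a) (z a) g y0 tau).
Proof.
move=> t0; have [l hl] := f_term_summable a g y0 t0.
suff -> : f_act D f (A a) (B a) (Cc a) (z a) g y0 tau = l by [].
exact: (Z2sum_has_sum hl).
Qed.

Local Notation lev := (f * absz D)%N.
Local Notation elt x y := (ofZ R (x : nat)%:Z + ofZ R (y : nat)%:Z * omega R D).

Definition gen_term a y0 tau p : C := ((absz D)%:R)^-1 *
  \sum_(x < lev) \sum_(y < lev)
     (if `[< coprime_id (pid (elt x y)) c >]
      then chi (elt x y) * f_term a (elt x y) y0 tau p else 0).

Lemma has_sum_F_gen a y0 tau : 0 < complex.Im tau ->
  has_sum (gen_term a y0 tau) (F_gen D f chi (A a) (B a) (Cc a) (z a) y0 tau).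
Proof.
move=> t0; rewrite /F_gen /gen_term /=.
apply: has_sumZ; apply: has_sum_sum => x; apply: has_sum_sum => y.
rewrite /=; case: asboolP => _; last exact: has_sum0.
by apply: has_sumZ; exact: has_sum_f_act.
Qed.

(* Each unit of [O_K / c] is counted [|D|] times. *)
Definition unit_count : C := \sum_(x < lev) \sum_(y < lev)
  (if `[< coprime_id (pid (elt x y)) c >] then 1 else 0).

Lemma unit_count_neq0 : unit_count != 0.
Proof.
have D1 := fund_disc_abs_gt1 hD.
have l1 : (1 < lev)%N by rewrite (leq_trans D1)// leq_pmull.
have l0 : (0 < lev)%N by exact: ltnW.
have ge0 (x y : 'I_lev) : 0 <= (if `[< coprime_id (pid (elt x y)) c >] then 1 else 0 : C).
  by case: ifP.
(* The residue of 1, at [x = 1] and [y = 0], contributes 1, and all other terms are nonnegative. *)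
rewrite /unit_count (bigD1 (Ordinal l1))//= (bigD1 (Ordinal l0))//=.
rewrite asboolT; last first.
  exists 1, 0; split; last by split; [exists 0; [exact: OK0|rewrite mulr0]|rewrite addr0].
  by rewrite /ofZ mul0r addr0; exact: pid_mem.
rewrite -addrA gt_eqF//; apply: ltr_pwDl => //.
apply: addr_ge0; apply: sumr_ge0 => x _; first by case: asboolP.
by apply: sumr_ge0 => y _; exact: ge0.
Qed.

Local Notation dd := (f * f * absz D)%N.

Lemma psi_congr a w l : in_lat l ->
  ps a (w + Omega f (A a) (B a) (Cc a) (z a) l) = ps a w.
Proof.
move=> hl; apply: (psi_periodic icf (iM a) (mu0 a) (hqb a) hqc hchi').
rewrite addrAC subrr add0r -(scal_cbar f (hzCM a)).
apply/(Omega_latP hD f0 (hzH a) (hzCM a) (hgcd a) (hA a) (hroot a)).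
by exists l.
Qed.

(* The fractions with numerators in [0, d[ represent the dual lattice modulo [Z^2]. *)
Lemma rep_sum a v (T : C) : b a v ->
  \sum_(ij : 'I_dd * 'I_dd | `[< in_dual f (A a) (B a) (Cc a) (fr a (ij.1%:Z, ij.2%:Z)) >])
     ps a (Om a (ij.1%:Z, ij.2%:Z)) *
     (if `[< exists l, in_lat l /\ v = Om a (ij.1%:Z, ij.2%:Z) +
               Omega f (A a) (B a) (Cc a) (z a) l >] then T else 0) = ps a v * T.
Proof.
move=> bv.
have hOc := Omega_frac_congr hD f0 (hzH a) (hzCM a) (hgcd a) (hA a) (hroot a).
have hdual := in_dualP hD f0 (hzH a) (hzCM a) (hgcd a) (hA a) (hroot a).
have [p hp] := Omega_surj hD f0 (hzH a) (hzCM a) (hgcd a) (hA a) (hroot a) bv.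
have d0 : (0 < dd)%N by rewrite !muln_gt0 f0 absz_gt0 lt_eqF.
have dz : dd%:Z != 0 by rewrite eqz_nat -lt0n.
have lt (x : int) : (absz (x %% dd%:Z)%Z < dd)%N.
  have := modz_ge0 x dz; have := ltz_pmod x (d0 : 0 < dd%:Z); lia.
have val (x : int) : (absz (x %% dd%:Z)%Z)%:Z = (x %% dd%:Z)%Z.
  by rewrite gez0_abs// modz_ge0.
pose ij0 : 'I_dd * 'I_dd := (Ordinal (lt p.1), Ordinal (lt p.2)).
have [l [hl e0]] : exists l, in_lat l /\
    v = Om a (ij0.1%:Z, ij0.2%:Z) + Omega f (A a) (B a) (Cc a) (z a) l.
  rewrite -hp; apply/hOc; rewrite /= !val.
  exists (p.1 %/ dd%:Z)%Z, (p.2 %/ dd%:Z)%Z.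
  by split; rewrite addrC -divz_eq.
have b0 : b a (Om a (ij0.1%:Z, ij0.2%:Z)).
  have -> : Om a (ij0.1%:Z, ij0.2%:Z) = v - Omega f (A a) (B a) (Cc a) (z a) l.
    by rewrite e0 addrK.
  apply: lattB => //.
  have : scal (f%:R * delta) (b a) (Omega f (A a) (B a) (Cc a) (z a) l).
    by apply/(Omega_latP hD f0 (hzH a) (hzCM a) (hgcd a) (hA a) (hroot a)); exists l.
  move=> [x bx <-]; case: (hb a) => _ _; apply=> //.
  by apply: (OKM hD); [exact: (OK_int R D f)|exact: OK_sqrtD].
rewrite (bigD1 ij0); last by apply/asboolP/hdual.
rewrite /= asboolT; last by exists l.
rewrite big1 ?addr0; first by rewrite [in RHS]e0 psi_congr.
move=> [i j] /= /andP[_ ne]; case: asboolP => [h1|]; last by rewrite mulr0.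
case/negP: ne; move: h1; rewrite -hp => /hOc /= [mm [nn [e1 e2]]].
have hi : (i : nat) = absz (p.1 %% dd%:Z)%Z.
  by rewrite e1 addrC modzMDl modz_small//; apply/andP; split => //; rewrite ltz_nat.
have hj : (j : nat) = absz (p.2 %% dd%:Z)%Z.
  by rewrite e2 addrC modzMDl modz_small//; apply/andP; split => //; rewrite ltz_nat.
by apply/eqP; congr pair; apply: val_inj.
Qed.

Lemma psi_eq0 a p : ~ b a (Om a p) -> ps a (Om a p) = 0.
Proof.
move=> nb0; rewrite /psi; case: asboolP => // -[/mu_M_sub_b h1 _]; case: nb0.
by move: h1; rewrite mulrCA divff// mulr1.
Qed.

(** Only the class of [g w] contributes, with weight [psi(g w) = chi'(g) psi(w)]; the factor
    [chi(g)] cancels [chi'(g)], so every [g] gives the same result. *)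
Lemma f_term_rep_sum a tau p g : OK g -> coprime_id (pid g) c ->
  \sum_(ij : 'I_dd * 'I_dd | `[< in_dual f (A a) (B a) (Cc a) (fr a (ij.1%:Z, ij.2%:Z)) >])
     ps a (Om a (ij.1%:Z, ij.2%:Z)) * (chi g * f_term a g (fr a (ij.1%:Z, ij.2%:Z)) tau p) =
  psi_term a tau p.
Proof.
move=> og cg.
have hdual := in_dualP hD f0 (hzH a) (hzCM a) (hgcd a) (hA a) (hroot a).
have [bp|nbp] := pselect (b a (Om a p)); last first.
  rewrite /psi_term psi_eq0// !mul0r big1// => ij _.
  by rewrite /f_term asboolF ?mulr0// => -[/hdual].
have bg : b a (g * Om a p) by case: (hb a) => _ _; apply.
have := rep_sum (kap a * Om a p * q_exp a tau p) bg.
rewrite (psi_equivariant hD icf (iM a) (mu0 a) (hqb a) hqc hchi' hcf og cg bp) => e.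
have c0 : chi g != 0 by case: hchi => _ [_]; apply.
transitivity (chi g * (chi' g * ps a (Om a p) * (kap a * Om a p * q_exp a tau p))); last first.
  by rewrite hpull// /psi_term !mulrA divff// mul1r.
rewrite -e mulr_sumr; apply: eq_bigr => ij _; rewrite mulrCA; congr (_ * (_ * _)).
rewrite /f_term q_exp_gram (Omega'E hD f0 (hzH a) (hzCM a) (hgcd a) (hA a) (hroot a)).
case: asboolP => h1; case: asboolP => h2 //.
  by case: h2; case: h1.
by case: h1; split=> //; exact/hdual.
Qed.

Lemma gen_term_rep_sum a tau p :
  \sum_(ij : 'I_dd * 'I_dd | `[< in_dual f (A a) (B a) (Cc a) (fr a (ij.1%:Z, ij.2%:Z)) >])
     ps a (Om a (ij.1%:Z, ij.2%:Z)) * gen_term a (fr a (ij.1%:Z, ij.2%:Z)) tau p =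
  ((absz D)%:R)^-1 * unit_count * psi_term a tau p.
Proof.
rewrite /gen_term -mulrA; under eq_bigr do rewrite mulrCA mulr_sumr.
rewrite -mulr_sumr; congr (_ * _).
rewrite exchange_big /= /unit_count mulr_suml; apply: eq_bigr => x _.
under eq_bigr do rewrite mulr_sumr.
rewrite exchange_big /= mulr_suml; apply: eq_bigr => y _.
case: asboolP => cg; last by rewrite mul0r big1// => ij _; rewrite mulr0.
rewrite mul1r; apply: f_term_rep_sum => //.
by exists x%:Z, y%:Z.
Qed.

(** From [phi(I) = alpha psi(w) / phi(M)] and [alpha = (kappa w) / (kappa mu)]. *)
Definition theta_scale a : C := (phi (M a) * kap a * mu a)^-1.

Lemma norm_fibre_term tau k x : norm_fibre k x ->
  phi0 (ideal_of x) * cexp (2%:R * ofR pi * 'i * (r%:R * tau) * k%:R) =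
  theta_scale x.1 * psi_term x.1 tau x.2.
Proof.
case: x => a p [/= Mx x0 e]; rewrite /ideal_of /= phi0_quot_ideal//.
have oE : mu a * alpha a p = Om a p by rewrite /alpha mulrCA divff// mulr1.
(* The exponents agree: [A |w|^2 = A |mu|^2 |alpha|^2 = A |mu|^2 m k = r k]. *)
have -> : cexp (2%:R * ofR pi * 'i * (r%:R * tau) * k%:R) = q_exp a tau p.
  rewrite /q_exp -oE conjcM; congr cexp.
  have -> : (A a)%:~R * (mu a * alpha a p * ((mu a)^* * (alpha a p)^*)) =
     (A a)%:~R * (mu a * (mu a)^*) * (alpha a p * (alpha a p)^*) by ring.
  rewrite e.
  have -> : (A a)%:~R * (mu a * (mu a)^*) * (k%:R * m a) =
     (A a)%:~R * (mu a * (mu a)^*) * m a * k%:R by ring.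
  by rewrite -hrm; ring.
rewrite /psi_term /theta_scale oE [RHS]mulrA; congr (_ * _).
have h1 := phi_M_neq0 a; have h2 := mu0 a.
have h3 := kappa_neq0 R hD f0 (hA a).
move: (ps a _) (kappa _ _ _ _) h3 => w ka h3.
rewrite /alpha; move: (Omega _ _ _ _ _ _) => om; field.
by rewrite h1 h2 h3.
Qed.

(** A point with nonzero term yields an integral ideal, whose norm is its only level; the origin
    drops out because the term carries the factor [w]. *)
Lemma psi_term_support a tau p n : psi_term a tau p != 0 -> alpha a p * (alpha a p)^* < n%:R * m a ->
  exists2 k : 'I_n, norm_fibre k (a, p) & forall k' : nat, norm_fibre k' (a, p) -> k' = k :> nat.
Proof.
rewrite /psi_term /psi -/(alpha a p); case: asboolP => [[Mx _]|_]; last by rewrite !mul0r eqxx.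
move=> H0 hlt; have om0 : Om a p != 0.
  by apply: contra_neq H0 => ->; rewrite !(mulr0, mul0r).
have x0 : alpha a p != 0 by rewrite mulf_neq0// invr_eq0.
have [k _ hk] := ideal_has_rel_norm hD (quot_ideal_is_ideal (nM a) (iM a) Mx x0).
have := rel_norm_unique hD hk (rel_norm_quot_ideal (nM a) x0) => e.
have e' : alpha a p * (alpha a p)^* = k%:R * m a by rewrite e divfK.
have kn : (k < n)%N by move: hlt; rewrite e' ltr_pM2r// ltr_nat.
exists (Ordinal kn); first by split.
move=> k' [_ _ /= e2]; apply/eqP; rewrite -(eqr_nat C).
by apply/eqP; apply: (mulIf (m0' a)); rewrite -e2 e'.
Qed.

Lemma level_seq : exists E : 'I_h -> nat -> seq (int * int), forall a n,
  uniq (E a n) /\ forall p, (p \in E a n) = (alpha a p * (alpha a p)^* < n%:R * m a).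
Proof.
have h1 (x : 'I_h * nat) : exists s : seq (int * int),
  uniq s /\ forall p, (p \in s) = (alpha x.1 p * (alpha x.1 p)^* < x.2%:R * m x.1).
  have [N hN] := level_box x.1 x.2.
  exists [seq p <- box N | alpha x.1 p * (alpha x.1 p)^* < x.2%:R * m x.1].
  split; first by rewrite filter_uniq// box_uniq.
  move=> p; rewrite mem_filter; case: (boolP (_ < _)) => //= hlt; apply: hN; exact: ltW.
have [E hE] := choice h1.
by exists (fun a n => E (a, n)) => a n; exact: (hE (a, n)).
Qed.

(** The cut-off [|alpha|^2 < n m] is [Nm(I) < n], so the partial sums agree exactly; points that
    belong to no ideal have zero terms. *)
Lemma theta_partial (E : 'I_h -> nat -> seq (int * int)) tau n :
  (forall a n, uniq (E a n) /\ forall p, (p \in E a n) = (alpha a p * (alpha a p)^* < n%:R * m a)) ->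
  \sum_(0 <= k < n) theta_coef D cf phi k *
     cexp (2%:R * ofR pi * 'i * (r%:R * tau) * k%:R) =
  \sum_(a : 'I_h) \sum_(p <- E a n) num_units^-1 * theta_scale a * psi_term a tau p.
Proof.
move=> hE; apply: (mulfI num_units_neq0).
pose T (x : 'I_h * (int * int)) := theta_scale x.1 * psi_term x.1 tau x.2.
pose s := [seq (a, p) | a <- enum 'I_h, p <- E a n].
have us : uniq s.
  apply: allpairs_uniq_dep; [exact: enum_uniq|by move=> a _; case: (hE a n)|].
  by move=> [a p] [a' p'] _ _ /= [-> ->].
have mems a p : ((a, p) \in s) = (alpha a p * (alpha a p)^* < n%:R * m a).
  apply/allpairsPdep/idP => [[a' [p' [_ + [-> ->]]]]|hp].
    by case: (hE a' n) => _ ->.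
  by exists a, p; rewrite mem_enum; split=> //; case: (hE a n) => _ ->.
transitivity (\sum_(x <- s) T x); last first.
  rewrite big_allpairs_dep /= big_enum /= mulr_sumr; apply: eq_bigr => a _.
  rewrite mulr_sumr; apply: eq_bigr => p _; rewrite /T /= !mulrA divff ?mul1r//.
  exact: num_units_neq0.
transitivity (\sum_(k < n) \sum_(x <- s | x \in norm_fibre k) T x).
  rewrite big_mkord mulr_sumr; apply: eq_bigr => k _.
  rewrite [LHS]mulrA theta_coef_norm_fibre mulr_fsuml.
  rewrite (eq_fsbigr T); last by move=> x; rewrite inE => hx; exact: norm_fibre_term.
  rewrite fsbig_finite; last exact: norm_fibre_finite.
  rewrite -[RHS]big_filter; apply: perm_big; apply: uniq_perm.
  - exact: fset_uniq.
  - exact: filter_uniq.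
  - move=> [a p]; rewrite mem_filter in_fset_set; last exact: norm_fibre_finite.
    apply/idP/idP => [hx|/andP[]//]; rewrite hx /= mems.
    by have [_ _ /= ->] := set_mem hx; rewrite ltr_pM2r// ltr_nat.
rewrite (exchange_big_dep xpredT)//= big_seq [RHS]big_seq; apply: eq_bigr => -[a p].
rewrite mems => hlt; have [T0|T0] := eqVneq (T (a, p)) 0.
  by rewrite T0 big1.
have H0 : psi_term a tau p != 0 by apply: contra_neq T0; rewrite /T /= => ->; rewrite mulr0.
have [k hk uk] := psi_term_support H0 hlt.
rewrite (big_pred1 k)// => k'; rewrite /= ; apply/idP/eqP => [|->]; rewrite inE//.
by move=> /uk e; apply: val_inj.
Qed.

Lemma theta_eq (S : 'I_h -> C) tau :
  (forall a, has_sum (fun p => num_units^-1 * theta_scale a * psi_term a tau p) (S a)) ->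
  theta D cf phi (r%:R * tau) = \sum_(a : 'I_h) S a.
Proof.
move=> hS; have [E hE] := level_seq.
rewrite /theta; apply: cvg_Cnf_lim.
rewrite (_ : series _ = (fun n => \sum_(a : 'I_h) \sum_(p <- E a n) num_units^-1 * theta_scale a * psi_term a tau p : Cnf R)).
  apply: cvg_sum_seq => a; apply: (has_sum_cvg (hS a)) => [n|N].
    by case: (hE a n).
  have hs (s : seq (int * int)) : exists k0, forall n, (k0 <= n)%N -> {subset s <= E a n}.
    elim: s => [|p s [n1 ih]]; first by exists 0%N.
    have vR : alpha a p * (alpha a p)^* / m a \is Num.real.
      by rewrite ger0_real// divr_ge0 ?mul_conjc_ge0// ltW.
    (* The first integer above [|alpha|^2 / m], from which on the point [p] belongs to the
       sublevel. *)
    pose n2 := (Num.trunc (complex.Re (alpha a p * (alpha a p)^* / m a))).+1.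
    have n2P : alpha a p * (alpha a p)^* < n2%:R * m a.
      rewrite -ltr_pdivrMr// -(RRe_real vR) -(rmorph_nat (real_complex R)) ltcR.
      exact: truncnS_gt.
    exists (maxn n1 n2) => n; rewrite geq_max => /andP[h1 h2] p'.
    rewrite inE => /orP[/eqP ->|/(ih n h1)//].
    have [_ ->] := hE a n; apply: (lt_le_trans n2P).
    by rewrite ler_pM2r// ler_nat.
  exact: hs.
apply/funext => n; rewrite -(theta_partial tau n hE).
by rewrite /series /=.
Qed.

Lemma oldform_in_span : exists s : seq ('I_h * (rat * rat) * C),
    (forall e, e \in s -> in_dual f (A e.1.1) (B e.1.1) (Cc e.1.1) e.1.2) /\
    forall tau : C, 0 < complex.Im tau ->
      r%:R * theta D cf phi (r%:R * tau) =
      \sum_(e <- s) e.2 * F_gen D f chi (A e.1.1) (B e.1.1) (Cc e.1.1) (z e.1.1) e.1.2 tau.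
Proof.
pose y0 a (ij : 'I_dd * 'I_dd) := fr a (ij.1%:Z, ij.2%:Z).
(* The factor [|D| / unit_count] undoes the multiplicity of [gen_term_rep_sum], and [num_units^-1]
   the repetition of each ideal. *)
pose co a (ij : 'I_dd * 'I_dd) : C :=
  num_units^-1 * theta_scale a * ((absz D)%:R / unit_count) * ps a (Om a (ij.1%:Z, ij.2%:Z)).
pose P a ij := `[< in_dual f (A a) (B a) (Cc a) (y0 a ij) >].
exists [seq (x.1, y0 x.1 x.2, r%:R * co x.1 x.2) |
   x <- [seq (a, ij) | a <- enum 'I_h, ij <- [seq ij <- enum {: 'I_dd * 'I_dd} | P a ij]]].
split.
  move=> e /mapP [_ /allpairsPdep [a [ij [_ + ->]]] ->] /=.
  by rewrite mem_filter => /andP[/asboolP].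
move=> tau t0.
pose S a : C := \sum_(ij : 'I_dd * 'I_dd | P a ij)
  co a ij * F_gen D f chi (A a) (B a) (Cc a) (z a) (y0 a ij) tau.
rewrite (@theta_eq S).
  rewrite big_map big_allpairs_dep /= big_enum /= mulr_sumr; apply: eq_bigr => a _.
  rewrite big_filter big_enum_cond /= mulr_sumr; apply: eq_bigr => ij _.
  by rewrite mulrA.
move=> a.
have h1 : has_sum (fun p => \sum_(ij <- [seq ij <- enum {: 'I_dd * 'I_dd} | P a ij])
    co a ij * gen_term a (y0 a ij) tau p) (\sum_(ij <- [seq ij <- enum {: 'I_dd * 'I_dd} | P a ij])
    co a ij * F_gen D f chi (A a) (B a) (Cc a) (z a) (y0 a ij) tau).
  apply: has_sum_sum => ij; apply: has_sumZ; exact: has_sum_F_gen.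
rewrite big_filter big_enum_cond /= in h1.
apply: has_sum_ext h1 => p; rewrite big_filter big_enum_cond /=.
have D0' : ((absz D)%:R : C) != 0 by rewrite pnatr_eq0 absz_eq0 lt_eqF.
have n00 := unit_count_neq0.
transitivity (num_units^-1 * theta_scale a * ((absz D)%:R / unit_count) * (((absz D)%:R)^-1 * unit_count * psi_term a tau p)).
  rewrite -gen_term_rep_sum mulr_sumr; apply: eq_bigr => ij _.
  by rewrite /co !mulrA.
move: (num_units^-1 * theta_scale a) (psi_term a tau p) unit_count n00 => X H n n00.
by field; rewrite n00 D0'.
Qed.

End Assembly.

Theorem theorem3p3p12
  (R : realType) (D : int) (hD : neg_fund_disc D)
  (f : nat) (hf : (0 < f)%N)
  (* z_1, ..., z_h : representatives of the C-isomorphism classes of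
     elliptic curves with CM by O_K, i.e. of lattices with End = O_K *)
  (h : nat) (z : 'I_h -> R[i])
  (hzH : forall a, 0 < complex.Im (z a))
  (hzCM : forall a, latt_End (latt 1 (z a)) = OK D)
  (hzdist : forall a b, a != b -> ~ homothetic (latt 1 (z a)) (latt 1 (z b)))
  (hzall : forall w1 w2 : R[i], w1 != 0 -> complex.Im (w2 / w1) != 0 ->
             latt_End (latt w1 w2) = OK D ->
             exists a, homothetic (latt w1 w2) (latt 1 (z a)))
  (* (a_z, b_z, c_z) *)
  (A B Cc : 'I_h -> int)
  (hABC : forall a, [/\ gcdz (gcdz (A a) (B a)) (Cc a) = 1, 0 < A a &
            ofZ R (A a) * z a ^+ 2 + ofZ R (B a) * z a + ofZ R (Cc a) = 0])
  (* chi : character of (O_K / c)^x with chi(u) = u on units *)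
  (chi : R[i] -> R[i])
  (hchi : residue_char D (cbar D f) chi)
  (hchiu : forall u, OK D u -> u != 0 -> OK D u^-1 -> chi u = u)
  (* phi : Hecke character of infinity type [-1/2;1,0], conductor cf | c *)
  (phi : set R[i] -> R[i]) (cf : set R[i]) (chi' : R[i] -> R[i])
  (hphi : hecke_char D cf phi chi')
  (hcf : cbar D f `<=` cf)
  (hpull : forall a, OK D a -> coprime_id (pid D a) (cbar D f) ->
             chi' a = (chi a)^-1)
  (r : nat) (hr : (0 < r)%N)
  (hq : exists q, [/\ is_ideal D q, ideal_norm D q r & cbar D f `<=` idmul q cf]) :
  exists s : seq ('I_h * (rat * rat) * R[i]),
    (forall e, e \in s -> in_dual f (A e.1.1) (B e.1.1) (Cc e.1.1) e.1.2) /\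
    forall tau : R[i], 0 < complex.Im tau ->
      r%:R * theta D cf phi (r%:R * tau) =
      \sum_(e <- s) e.2 * F_gen D f chi (A e.1.1) (B e.1.1) (Cc e.1.1) (z e.1.1) e.1.2 tau.
Proof.
have [q [iq nq hqc]] := hq; have nq' := ideal_rel_norm hD iq nq.
have /choice[t ht] := rep_exists hD hf hzH hzCM hABC hphi hcf iq nq'.
apply: (oldform_in_span hD hf hzH hzCM hzdist hzall hABC hphi hcf hr iq nq' hqc
  (M := fun a => (t a).1.1) (mu := fun a => (t a).1.2) (m := fun a => (t a).2)) => // a;
  by have [? ? ? ? []] := ht a.
Qed.
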